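(* Let $G'$ be a finite graph with at least two vertices, and let $G(\infty)$ be the infinite limit of the preferential attachment process $(G(t))_{t}$ started from $G'$. Then: (1) If $G'$ is complete, then $G(\infty)$ is complete. (2) If $G'$ is edgeless, then $G(\infty)$ is edgeless. (3) If $G'$ is neither complete nor edgeless, then with probability $1$ the graph $G(\infty)$ is isomorphic to one of the following: the Rado graph augmented with a finite number of isolated vertices; or the Rado graph augmented with a finite number of universal vertices.
   Context: All graphs are simple and undirected. The process: the vertex set of $G'$ is taken to be $\{0,1,\dots,v'\}$ (so $v'\ge 1$), and $G(t):=G'$ for all $t\le v'$. For $t\ge v'$, the random graph $G(t+1)$ is obtained from $G(t)$ by introducing a new vertex $t+1$ and, conditionally on the process up to time $t$, connecting it to each previous vertex $u\in\{0,\dots,t\}$ with probability $d_u(t)/t$, independently for distinct $u$, where $d_u(t)$ is the degree of $u$ in $G(t)$. Thus $G(t)$ has vertex set $\{0,\dots,t\}$ for $t\ge v'$. The infinite limit $G(\infty)$ is the union of all $G(t)$: its vertex set is $\{0,1,2,\dots\}$ and two vertices are adjacent iff they are adjacent in some $G(t)$. The Rado graph is the (unique up to isomorphism) graph on a countably infinite vertex set such that for any disjoint finite sets of vertices $U$ and $V$ there is a vertex $v\notin U\cup V$ adjacent to every vertex of $V$ and to no vertex of $U$. An isolated vertex is one adjacent to no other vertex; a universal vertex is one adjacent to every other vertex. A graph augmented with finitely many isolated (resp. universal) vertices is the graph obtained by adding $k$ new vertices, for some finite $k\ge 0$, each adjacent to no other vertex (resp. each adjacent to all other vertices, including the other new ones).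 *)

(* Defs.v *)
From HB Require Import structures.
From mathcomp Require Import all_boot all_order all_algebra.
From mathcomp Require Import all_classical all_reals all_analysis.

Set Implicit Arguments.
Unset Strict Implicit.
Unset Printing Implicit Defensive.

Import Order.TTheory GRing.Theory Num.Theory.

Local Open Scope classical_set_scope.
Local Open Scope card_scope.
Local Open Scope ring_scope.

Record sgraph (V : Type) := SGraph {
  adj :> V -> V -> bool;
  adj_sym : symmetric adj;
  adj_irr : irreflexive adj }.

Definition complete_graph (V : Type) (g : sgraph V) : Prop :=
  forall u v : V, u <> v -> g u v.

Definition edgeless_graph (V : Type) (g : sgraph V) : Prop :=
  forall u v : V, ~~ g u v.

Definition graph_iso (V W : Type) (g : sgraph V) (h : sgraph W) : Prop :=
  exists2 f : V -> W, bijective f & forall u v : V, h (f u) (f v) = g u v.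

Definition is_rado (V : Type) (g : sgraph V) : Prop :=
  [set: V] #= [set: nat] /\
  forall A B : set V, finite_set A -> finite_set B -> A `&` B = set0 ->
    exists v : V, [/\ ~ (A `|` B) v,
                      forall b, B b -> g v b
                    & forall a, A a -> ~~ g v a].

Section Augment.
Variables (V : Type) (g : sgraph V) (k : nat).

Definition isolated_adj (x y : V + 'I_k) : bool :=
  match x, y with
  | inl u, inl v => g u v
  | _, _ => false
  end.

Lemma isolated_adj_sym : symmetric isolated_adj.
Proof. by case=> [u|i] [v|j] //=; exact: adj_sym. Qed.

Lemma isolated_adj_irr : irreflexive isolated_adj.
Proof. by case=> [u|i] //=; exact: adj_irr. Qed.

Definition add_isolated : sgraph (V + 'I_k) :=
  SGraph isolated_adj_sym isolated_adj_irr.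

Definition universal_adj (x y : V + 'I_k) : bool :=
  match x, y with
  | inl u, inl v => g u v
  | inr i, inr j => i != j
  | _, _ => true
  end.

Lemma universal_adj_sym : symmetric universal_adj.
Proof. by case=> [u|i] [v|j] //=; [exact: adj_sym|rewrite eq_sym]. Qed.

Lemma universal_adj_irr : irreflexive universal_adj.
Proof. by case=> [u|i] /=; [exact: adj_irr|rewrite eqxx]. Qed.

Definition add_universal : sgraph (V + 'I_k) :=
  SGraph universal_adj_sym universal_adj_irr.

End Augment.

Definition rado_plus_isolated (V : Type) (g : sgraph V) : Prop :=
  exists (W : Type) (rado : sgraph W) (k : nat),
    is_rado rado /\ graph_iso g (add_isolated rado k).

Definition rado_plus_universal (V : Type) (g : sgraph V) : Prop :=
  exists (W : Type) (rado : sgraph W) (k : nat),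
    is_rado rado /\ graph_iso g (add_universal rado k).

(* Degree of u in a graph with vertex set {0, ..., t}. *)
Definition deg (t : nat) (g : rel nat) (u : nat) : nat :=
  #|[pred v : 'I_t.+1 | g u v]|.

(* [G t w] is the graph G(t) at the outcome w. It is a graph on nat, of which
   only 0, ..., maxn v' t count as vertices; [pa_support] says that no edge
   leaves this set. The field [pa_law] is the conditional law of the
   neighbourhood of the new vertex given the history: the history up to time t
   takes finitely many values, so conditioning on it is conditioning on the
   events {G(s) = h s for all s <= t}. Multiplying by the probability of that
   event avoids dividing by 0. *)
Record preferential_attachment (R : realType) (d : measure_display)
    (T : measurableType d) (P : probability T R)
    (v' : nat) (G' : sgraph 'I_v'.+1) (G : nat -> T -> sgraph nat) : Prop := {
  pa_measurable : forall t u v : nat, measurable [set w | G t w u v];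
  pa_support : forall (t : nat) (w : T) (u v : nat),
    G t w u v -> (u <= maxn v' t)%N && (v <= maxn v' t)%N;
  pa_init : forall (t : nat) (w : T) (i j : 'I_v'.+1),
    (t <= v')%N -> G t w i j = G' i j;
  pa_step : forall (t : nat) (w : T) (u v : nat), (v' <= t)%N ->
    (u <= t)%N -> (v <= t)%N -> G t.+1 w u v = G t w u v;
  pa_law : forall (t : nat) (h : nat -> rel nat) (N : {set 'I_t.+1}),
    (v' <= t)%N ->
    let history := [set w | forall s u v : nat, (s <= t)%N ->
                              G s w u v = h s u v] in
    let new_edges := [set w | forall u : 'I_t.+1,
                                G t.+1 w t.+1 u = (u \in N)] in
    let p (u : 'I_t.+1) : R := (deg t (h t) u)%:R / t%:R in
    P (history `&` new_edges) =
      (P history * (\prod_(u < t.+1) (if u \in N then p u else 1 - p u))%:E)%E }.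

Section Limit.
Variable g : nat -> sgraph nat.

Definition limit_adj (u v : nat) : bool := `[< exists t : nat, g t u v >].

Lemma limit_adj_sym : symmetric limit_adj.
Proof.
by move=> u v; apply/asboolP/asboolP => -[t guv]; exists t; rewrite adj_sym.
Qed.

Lemma limit_adj_irr : irreflexive limit_adj.
Proof. by move=> u; apply/asboolP => -[t]; rewrite adj_irr. Qed.

Definition limit_graph : sgraph nat := SGraph limit_adj_sym limit_adj_irr.

End Limit.

(* Main.v *)
Require Import Defs.
From mathcomp Require Import all_boot all_order all_algebra.
From mathcomp Require Import all_classical all_reals all_analysis.
From mathcomp Require Import measurable_realfun.
From mathcomp Require Import ring lra zify.

(** A vertex of degree d in G(t) is joined to the next vertex with probability
    d/t, so its pair (degree, t - degree) evolves as a Polya urn, and given the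
    present the urns of distinct vertices are independent. An urn that contains
    both colours keeps both proportions away from 0: the potential
    1/d + 1/(d+1) + ... + 1/(t-1), about ln (t/d), is a martingale
    ([urn_pot_step]), so it does not grow in the mean, and while it is bounded
    so is the proportion d/t from below ([le_expR_urn_pot]). Therefore any
    prescribed pattern of adjacency to finitely many non-isolated,
    non-universal vertices has, at each step, a probability that stays bounded
    below unless the potential is large, and some later vertex almost surely
    realizes it ([ae_matches]). This is the extension property of the Rado
    graph, restricted to the vertices that are neither isolated nor universal
    in the limit ([ae_extension]).

    It remains to bound the number of exceptional vertices. If S is the sum of
    the degrees in G(t), the next vertex is born isolated with probability at
    most exp (- S/t) <= 27 (t/S)^3. As S grows on average by the factor
    1 + 2/t per step, t^5/S^3 is a supermartingale once S and t are large
    ([bern_cube_step]), whence the probability of an isolated birth at time t is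
    O(t^-2), and the Borel-Cantelli lemma leaves finitely many of them
    ([ae_finitely_many_isolated_births]). That S becomes large follows from the
    recurrence of patterns as soon as G' has an edge. The whole process is
    invariant under complementation, since 1 - d/t is the attachment
    probability for the complementary degree t - d
    ([compl_preferential_attachment]). Hence only finitely many vertices are
    universal in the limit if G' is not complete, and the complete case reduces
    to the edgeless one.

    Finally, an isolated vertex and a universal vertex cannot coexist, so one of
    the two exceptional sets is empty; removing the other, which is finite,
    leaves a Rado graph ([rado_dichotomy]).

    Expectations are only needed for functions of the history up to some time t.
    Such functions take finitely many values, which settles all measurability
    questions, and the law of the process enters through one-step averages
    ([Ex_new], [Ex_step]). *)

Set Implicit Arguments.
Unset Strict Implicit.
Unset Printing Implicit Defensive.

Import Order.TTheory GRing.Theory Num.Theory.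

Local Open Scope classical_set_scope.
Local Open Scope card_scope.
Local Open Scope ring_scope.

(** * Recognizing augmented Rado graphs *)

Lemma graph_iso_of_bij (V W : Type) (g : sgraph V) (h : sgraph W) (f : W -> V) :
  injective f -> (forall v, exists x, f x = v) ->
  (forall x y, g (f x) (f y) = h x y) -> graph_iso g h.
Proof.
move=> finj fsurj fE.
pose e v := projT1 (cid (fsurj v)).
have eK v : f (e v) = v by rewrite /e; case: cid.
exists e => [|u v]; last by rewrite -fE !eK.
by exists f => // x; apply: finj; rewrite eK.
Qed.

Lemma seq_ubound (s : seq nat) : exists m, forall x, x \in s -> (x < m)%N.
Proof.
exists (\max_(x <- s) x).+1 => x xs; rewrite ltnS.
exact: (leq_bigmax_seq (F := id)).
Qed.

(** The extension property of the Rado graph required only of vertices that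
    may belong to the Rado part. Asking for witnesses beyond any bound [m] is
    what makes it possible to choose them outside a finite exceptional set. *)
Definition extension_property (g : sgraph nat) :=
  forall (A B : seq nat) (m : nat),
    (forall a, a \in A -> exists2 v, v != a & ~~ g a v) ->
    (forall b, b \in B -> exists v, g b v) ->
    (forall a, a \in A -> a \notin B) ->
    exists x, [/\ (m <= x)%N, forall b, b \in B -> g x b
                & forall a, a \in A -> ~~ g x a].

Section RadoPart.
Variables (g : sgraph nat) (X : seq nat).
Hypothesis uX : uniq X.
Hypothesis ext : extension_property g.
Hypothesis edgeX : forall u, u \notin X -> exists v, g u v.
Hypothesis nonedgeX : forall u, u \notin X -> exists2 v, v != u & ~~ g u v.

Definition outside := {u : nat | u \notin X}.

Definition out u (p : u \notin X) : outside := exist _ u p.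

Definition outside_adj (x y : outside) : bool := g (val x) (val y).

Lemma outside_adj_sym : symmetric outside_adj.
Proof. by move=> x y; rewrite /outside_adj adj_sym. Qed.

Lemma outside_adj_irr : irreflexive outside_adj.
Proof. by move=> x; rewrite /outside_adj adj_irr. Qed.

Definition outside_graph : sgraph outside :=
  SGraph outside_adj_sym outside_adj_irr.

(** The witnesses given by the extension property can be taken larger than
    every element of [X] and of the two prescribed sets, hence they lie in the
    subgraph and are new. *)
Lemma outside_rado : is_rado outside_graph.
Proof.
have [M hM] := seq_ubound X.
have XM x : (M <= x)%N -> x \notin X by apply: contraTN => /hM; rewrite ltnNge.
split.
  apply: eq_card_nat; first exact: countableP.
  move=> /finite_seqP[s hs].
  have [k hk] := seq_ubound (map val s).
  have p : maxn k M \notin X by rewrite XM // leq_maxr.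
  have : [set: outside] (out p) by [].
  rewrite hs /= => /(map_f val) /hk /=; rewrite ltnNge leq_maxl //.
move=> A B /finite_seqP[a ->] /finite_seqP[b ->] AB0.
have [k hk] := seq_ubound (map val (a ++ b)).
have [x [Mx xB xA]] : exists x, [/\ (maxn k M <= x)%N,
    forall u, u \in map val b -> g x u & forall u, u \in map val a -> ~~ g x u].
  apply: ext.
  - by move=> _ /mapP[u _ ->]; apply: nonedgeX (valP u).
  - by move=> _ /mapP[u _ ->]; apply: edgeX (valP u).
  - move=> _ /mapP[u ua ->]; apply/negP => /mapP[v vb /val_inj e].
    by have : set0 u by rewrite -AB0; split => //=; rewrite e.
have p : x \notin X by rewrite XM // (leq_trans _ Mx) // leq_maxr.
exists (out p); split.
- move=> h; have : x \in map val (a ++ b).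
    by apply/mapP; exists (out p) => //; rewrite mem_cat; case: h => /= ->;
      rewrite ?orbT.
  by move=> /hk; rewrite ltnNge (leq_trans _ Mx) // leq_maxl.
- by move=> u /= ub; apply: xB; apply: map_f.
- by move=> u /= ua; apply: xA; apply: map_f.
Qed.

Definition outside_or_index (x : outside + 'I_(size X)) : nat :=
  match x with inl u => val u | inr i => nth 0%N X i end.

Lemma outside_or_index_inj : injective outside_or_index.
Proof.
move=> [u|i] [v|j] /=.
- by move=> /val_inj ->.
- by move=> e; have := valP u; rewrite /= e mem_nth.
- by move=> e; have := valP v; rewrite /= -e mem_nth.
- by move/eqP; rewrite nth_uniq // => /eqP /val_inj ->.
Qed.

Lemma outside_or_index_surj v : exists x, outside_or_index x = v.
Proof.
case: (boolP (v \in X)) => [vX|p]; last by exists (inl (out p)).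
have iX : (index v X < size X)%N by rewrite index_mem.
by exists (inr (Ordinal iX)); rewrite /= nth_index.
Qed.

Lemma rado_plus_isolated_of : (forall u v, u \in X -> ~~ g u v) ->
  rado_plus_isolated g.
Proof.
move=> isoX; exists outside, outside_graph, (size X); split; first exact: outside_rado.
apply: (graph_iso_of_bij outside_or_index_inj outside_or_index_surj).
move=> [u|i] [v|j] //=.
- by rewrite adj_sym; apply/negbTE/isoX/mem_nth.
- by apply/negbTE/isoX/mem_nth.
- by apply/negbTE/isoX/mem_nth.
Qed.

Lemma rado_plus_universal_of : (forall u v, u \in X -> v != u -> g u v) ->
  rado_plus_universal g.
Proof.
move=> uniX; exists outside, outside_graph, (size X); split; first exact: outside_rado.
apply: (graph_iso_of_bij outside_or_index_inj outside_or_index_surj).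
have gX (u : outside) (j : 'I_(size X)) : g (nth 0%N X j) (val u).
  apply: uniX; first exact: mem_nth.
  by apply: contraNneq (valP u) => ->; exact: mem_nth.
move=> [u|i] [v|j] //=.
- by rewrite adj_sym gX.
- exact: gX.
- case: (eqVneq i j) => [->|ij]; first by rewrite adj_irr.
  by apply: uniX; rewrite ?mem_nth // nth_uniq // eq_sym.
Qed.

End RadoPart.

(** Isolated and universal vertices exclude each other, so at most one of the
    two kinds is present; all of that kind are below [m], and the rest of the
    graph is a Rado graph. *)
Lemma rado_dichotomy (g : sgraph nat) (m : nat) :
  extension_property g ->
  (forall u, (m <= u)%N -> exists v, g u v) ->
  (forall u, (m <= u)%N -> exists2 v, v != u & ~~ g u v) ->
  rado_plus_isolated g \/ rado_plus_universal g.
Proof.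
move=> ext edge nonedge.
pose iso u := `[< forall v, ~~ g u v >].
pose uni u := `[< forall v, v != u -> g u v >].
have isoN u : ~~ iso u -> exists v, g u v.
  by move=> /asboolPn h; apply: contrapT => h'; apply: h => v; apply/negP => ?;
     apply: h'; exists v.
have uniN u : ~~ uni u -> exists2 v, v != u & ~~ g u v.
  move=> /asboolPn h; apply: contrapT => h'; apply: h => v vu.
  by apply: contrapT => /negP ?; apply: h'; exists v.
have mem_small (Q : pred nat) : (forall u, (m <= u)%N -> ~~ Q u) ->
    forall u, (u \in [seq u <- iota 0 m | Q u]) = Q u.
  move=> h u; rewrite mem_filter mem_iota /= add0n.
  by case: (leqP m u) => [/h/negbTE->|]; rewrite // andbT.
have isoE : forall u, (u \in [seq u <- iota 0 m | iso u]) = iso u.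
  apply: mem_small => u /edge[v guv]; apply/negP => /asboolP/(_ v).
  by rewrite guv.
have uniE : forall u, (u \in [seq u <- iota 0 m | uni u]) = uni u.
  apply: mem_small => u /nonedge[v vu guv]; apply/negP => /asboolP/(_ v vu).
  by rewrite (negbTE guv).
case: (pselect (exists u, uni u)) => [[y /asboolP uy]|nu].
  right.
  have noniso u : ~~ iso u.
    apply/negP => /asboolP iu.
    have [e|ne] := eqVneq u y; last by have := uy u ne; rewrite adj_sym (negbTE (iu _)).
    have ne : y.+1 != y by rewrite gtn_eqF.
    by have := uy _ ne; rewrite -e (negbTE (iu _)).
  apply: (@rado_plus_universal_of _ [seq u <- iota 0 m | uni u]) => //.
  - by rewrite filter_uniq // iota_uniq.
  - by move=> u _; exact: isoN.
  - by move=> u; rewrite uniE; exact: uniN.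
  - by move=> u v; rewrite uniE => /asboolP; apply.
left; apply: (@rado_plus_isolated_of _ [seq u <- iota 0 m | iso u]) => //.
- by rewrite filter_uniq // iota_uniq.
- by move=> u; rewrite isoE; exact: isoN.
- by move=> u _; apply: uniN; apply/negP => uu; apply: nu; exists u.
- by move=> u v; rewrite isoE => /asboolP; apply.
Qed.

(** * Random subsets with independent memberships *)

Section BernoulliSets.
Variables (R : realFieldType) (I : finType) (p : I -> R).

(** The law of a random subset of [I] that contains each [u] independently
    with probability [p u]; it is the law of the neighbourhood of a new
    vertex. *)
Definition bern_wt (N : {set I}) : R :=
  \prod_u (if u \in N then p u else 1 - p u).

(** Independence in its most general product form; it is the expansion of a
    product of binomials over all subsets, and the other moments are special
    cases. *)
Lemma bern_prod (a b : I -> R) :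
  \sum_N bern_wt N * (\prod_u if u \in N then a u else b u) =
  \prod_u (p u * a u + (1 - p u) * b u).
Proof.
rewrite bigA_distr; apply: eq_bigr => N _.
by rewrite -big_split /=; apply: eq_bigr => u _; case: ifP.
Qed.

Lemma bern_total : \sum_N bern_wt N = 1.
Proof.
transitivity (\prod_u (p u * 1 + (1 - p u) * 1)).
  rewrite -bern_prod; apply: eq_bigr => N _.
  by rewrite [X in _ * X]big1 ?mulr1 // => u _; case: ifP.
by rewrite big1 // => u _; ring.
Qed.

Lemma bern_pattern (D s : pred I) :
  \sum_N bern_wt N * [forall u, D u ==> ((u \in N) == s u)]%:R =
  \prod_(u | D u) (if s u then p u else 1 - p u).
Proof.
rewrite [RHS]big_mkcond /=.
transitivity (\prod_u (p u * (D u ==> s u)%:R + (1 - p u) * (D u ==> ~~ s u)%:R)).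
  rewrite -bern_prod; apply: eq_bigr => N _; congr (_ * _).
  case: (boolP [forall u, _]) => [/forallP h|].
    rewrite big1 // => u _; have := h u.
    by case: (D u); case: (u \in N); case: (s u).
  rewrite negb_forall => /existsP[u]; rewrite negb_imply => /andP[Du nu].
  rewrite (bigD1 u) //= Du /=.
  by move: nu; case: (u \in N); case: (s u) => //= _; rewrite mul0r.
by apply: eq_bigr => u _; case: (D u) => /=; case: (s u) => /=; ring.
Qed.

Lemma bern_mem (u : I) (f : bool -> R) :
  \sum_N bern_wt N * f (u \in N) = p u * f true + (1 - p u) * f false.
Proof.
transitivity (\prod_v (p v * (if v == u then f true else 1) +
                       (1 - p v) * (if v == u then f false else 1))).
  rewrite -bern_prod; apply: eq_bigr => N _; congr (_ * _).
  rewrite (bigD1 u) //= eqxx big1 ?mulr1; first by case: ifP.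
  by move=> v /negPf ->; case: ifP.
by rewrite (bigD1 u) //= eqxx big1 ?mulr1 // => v /negPf ->; ring.
Qed.

Lemma bern_mem2 (u v : I) : u != v ->
  \sum_N bern_wt N * ((u \in N)%:R * (v \in N)%:R) = p u * p v.
Proof.
move=> uv; transitivity (\prod_(w | pred2 u v w) p w); last first.
  rewrite (bigD1 u) /= ?eqxx // (bigD1 v) /= ?eqxx ?orbT 1?eq_sym ?uv //.
  by rewrite big1 ?mulr1 // => w; case: (w == u) => //=; case: (w == v).
rewrite -(bern_pattern (pred2 u v) xpredT); apply: eq_bigr => N _.
congr (_ * _); rewrite -natrM mulnb; congr ((_ : bool)%:R).
apply/andP/forallP => [[uN vN] w|h].
  by apply/implyP => /orP[] /eqP ->; rewrite ?uN ?vN.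
by move: (h u) (h v); rewrite /= !eqxx orbT /= => /eqP-> /eqP->.
Qed.

Lemma card_natr (N : {set I}) : #|N|%:R = \sum_u (u \in N)%:R :> R.
Proof. by rewrite -sum1_card natr_sum big_mkcond; apply: eq_bigr => u _; case: ifP. Qed.

Lemma bern_card : \sum_N bern_wt N * #|N|%:R = \sum_u p u.
Proof.
under eq_bigr => N _ do rewrite card_natr mulr_sumr.
rewrite exchange_big /=; apply: eq_bigr => u _.
by rewrite (bern_mem u (fun b => b%:R)) /=; ring.
Qed.

(** Off the diagonal the memberships are independent and contribute at most
    [(\sum_u p u) ^+ 2]; on the diagonal the square of an indicator is itself.
    *)
Lemma bern_card_sqr :
  \sum_N bern_wt N * #|N|%:R ^+ 2 <= \sum_u p u + (\sum_u p u) ^+ 2.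
Proof.
under eq_bigr => N _ do rewrite card_natr expr2 big_distrlr /= mulr_sumr.
rewrite exchange_big /= expr2 big_distrlr /= -big_split /=.
apply: ler_sum => u _.
under eq_bigr => N _ do rewrite mulr_sumr.
rewrite exchange_big /= (bigD1 u) //= [X in _ <= _ + X](bigD1 u) //=.
rewrite (eq_bigr (fun v => p u * p v)) => [|v vu]; last first.
  by rewrite bern_mem2 // eq_sym.
have -> : \sum_N bern_wt N * ((u \in N)%:R * (u \in N)%:R) = p u.
  by rewrite (bern_mem u (fun b => b%:R * b%:R)) /=; ring.
rewrite addrA lerD2r lerDl; exact: sqr_ge0.
Qed.

Hypothesis p01 : forall u, 0 <= p u <= 1.

Lemma bern_wt_ge0 N : 0 <= bern_wt N.
Proof.
by apply: prodr_ge0 => u _; case/andP: (p01 u) => ? ?; case: ifP => // _; lra.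
Qed.

End BernoulliSets.

(** * Potential functions *)

Section Potentials.
Variable R : realType.

(** A partial harmonic sum, about [ln (t / d)]. It is the conditional mean,
    given the present, of minus the logarithm of the limiting proportion of a
    Polya urn (a difference of digamma values), which is why it is a
    martingale. *)
Definition urn_pot (t d : nat) : R := \sum_(d <= i < t) i%:R^-1.

Lemma urn_pot_ge0 t d : 0 <= urn_pot t d.
Proof. by apply: sumr_ge0 => i _; rewrite invr_ge0. Qed.

(** The martingale property. Passing from [d] to [d + 1] removes the term [1 /
    d], with probability [d / t]: this cancels exactly the new term [1 / t].
    *)
Lemma urn_pot_step (t d : nat) : (0 < d <= t)%N ->
  d%:R / t%:R * urn_pot t.+1 d.+1 + (1 - d%:R / t%:R) * urn_pot t.+1 d =
  urn_pot t d.
Proof.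
move=> /andP[d0 dt].
have -> : urn_pot t.+1 d = d%:R^-1 + urn_pot t.+1 d.+1.
  by rewrite /urn_pot big_ltn // ltnS.
have e : urn_pot t.+1 d = urn_pot t d + t%:R^-1.
  by rewrite /urn_pot big_nat_recr.
have e' : urn_pot t.+1 d = d%:R^-1 + urn_pot t.+1 d.+1.
  by rewrite /urn_pot big_ltn // ltnS.
have -> : urn_pot t.+1 d.+1 = urn_pot t d + t%:R^-1 - d%:R^-1.
  by rewrite -e e'; ring.
have d0' : d%:R != 0 :> R by rewrite pnatr_eq0 -lt0n.
have t0' : t%:R != 0 :> R by rewrite pnatr_eq0 -lt0n (leq_trans d0).
by field; rewrite t0' d0'.
Qed.

(** As [t / d] is the product of the factors [1 + 1 / i], each at most the
    exponential of [1 / i], a bounded potential bounds the proportion [d / t]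
    away from 0. *)
Lemma le_expR_urn_pot (t d : nat) : (0 < d <= t)%N ->
  t%:R <= d%:R * expR (urn_pot t d).
Proof.
move=> /andP[d0]; elim: t => [|t IH]; first by rewrite leqn0 => /eqP ->; rewrite mul0r.
rewrite leq_eqVlt => /orP[/eqP <-|dt].
  by rewrite /urn_pot big_geq // expR0 mulr1.
have t0 : t%:R != 0 :> R by rewrite pnatr_eq0 -lt0n (leq_trans d0).
rewrite /urn_pot big_nat_recr //= expRD mulrA.
apply: (@le_trans _ _ (t%:R * (1 + t%:R^-1))).
  by rewrite mulrDr mulr1 divff // natr1.
apply: ler_pM => //; [exact: IH|exact: expR_ge1Dx].
Qed.

Lemma urn_pot_le (t d : nat) : (0 < d)%N -> urn_pot t d <= t%:R.
Proof.
move=> d0; rewrite /urn_pot big_nat.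
apply: (@le_trans _ _ (\sum_(d <= i < t) 1)).
  rewrite -big_nat; apply: ler_sum_nat => i /andP[di _].
  by rewrite invf_le1 ?ler1n ?ltr0n (leq_trans d0).
by rewrite sumr_const_nat ler_nat leq_subr.
Qed.

(** After clearing denominators the difference of the two sides is a
    polynomial in n/S with nonnegative coefficients. *)
Lemma inv_cube_le (S n : R) : 0 < S -> 0 <= n ->
  ((S + 2 * n) ^+ 3)^-1 <=
  (S ^+ 3)^-1 * (1 - 6 * n / S + 24 * n ^+ 2 / S ^+ 2).
Proof.
move=> S0 n0; set x := n / S.
have x0 : 0 <= x by rewrite divr_ge0 // ltW.
have -> : S + 2 * n = S * (1 + 2 * x) by rewrite /x; field; rewrite gt_eqF.
have -> : 1 - 6 * n / S + 24 * n ^+ 2 / S ^+ 2 = 1 - 6 * x + 24 * x ^+ 2.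
  by rewrite /x; field; rewrite gt_eqF.
rewrite exprMn invfM ler_pM2l ?invr_gt0 ?exprn_gt0 //.
rewrite -[X in X <= _]mul1r ler_pdivrMr; last by apply: exprn_gt0; lra.
rewrite -subr_ge0.
have -> : (1 - 6 * x + 24 * x ^+ 2) * (1 + 2 * x) ^+ 3 - 1 =
          80 * x ^+ 3 + 240 * x ^+ 4 + 192 * x ^+ 5 by ring.
have := exprn_ge0 3 x0; have := exprn_ge0 4 x0; have := exprn_ge0 5 x0; lra.
Qed.

(** Adding a random set of mean size [S / t] increases [S] by the factor [1 +
    2 / t] on average, so the inverse cube decreases by a factor close to 1 -
    6/t; the variance costs at most 1/t when [S] and [t] are at least 48. The
    resulting 1 - 5/t compensates the growth of the fifth power of [t]. Any
    power of [t] above the fourth would make the probabilities of isolated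
    births summable. *)
Lemma bern_cube_step (I : finType) (p : I -> R) (t S : nat) :
  (forall u, 0 <= p u <= 1) -> (48 <= t)%N -> (48 <= S)%N ->
  \sum_u p u = S%:R / t%:R ->
  \sum_N bern_wt p N * (t.+1%:R ^+ 5 / (S + 2 * #|N|)%:R ^+ 3) <=
  t%:R ^+ 5 / S%:R ^+ 3.
Proof.
move=> p01 t48 S48 pS.
have tR : 48 <= t%:R :> R by rewrite ler_nat.
have SR : 48 <= S%:R :> R by rewrite ler_nat.
have t0 : 0 < t%:R :> R by lra.
have S0 : 0 < S%:R :> R by lra.
have tn0 : t%:R != 0 :> R by rewrite gt_eqF.
have Sn0 : S%:R != 0 :> R by rewrite gt_eqF.
pose k : R := t.+1%:R ^+ 5 / S%:R ^+ 3.
have k0 : 0 <= k by rewrite divr_ge0 // exprn_ge0.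
apply: (@le_trans _ _ (\sum_N bern_wt p N * (k * (1 - 6 * #|N|%:R / S%:R +
    24 * #|N|%:R ^+ 2 / S%:R ^+ 2)))).
  apply: ler_sum => N _; rewrite ler_wpM2l ?bern_wt_ge0 // /k.
  rewrite -[X in _ <= X]mulrA ler_wpM2l ?exprn_ge0 // natrD natrM; exact: inv_cube_le.
have -> : \sum_N bern_wt p N * (k * (1 - 6 * #|N|%:R / S%:R +
    24 * #|N|%:R ^+ 2 / S%:R ^+ 2)) =
  k * (\sum_N bern_wt p N - 6 / S%:R * (\sum_N bern_wt p N * #|N|%:R)
    + 24 / S%:R ^+ 2 * (\sum_N bern_wt p N * #|N|%:R ^+ 2)).
  rewrite -mulNr !(mulr_sumr, mulrDr) -!big_split /=.
  by apply: eq_bigr => N _; field; rewrite Sn0.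
rewrite bern_total bern_card.
have h2 := bern_card_sqr p; rewrite pS in h2 *.
apply: (@le_trans _ _ (k * (1 - 5 / t%:R))).
  apply: ler_wpM2l => //.
  apply: (@le_trans _ _ (1 - 6 / S%:R * (S%:R / t%:R) +
      24 / S%:R ^+ 2 * (S%:R / t%:R + (S%:R / t%:R) ^+ 2))).
    by rewrite lerD2l ler_wpM2l // divr_ge0 // exprn_ge0.
  have -> : 1 - 6 / S%:R * (S%:R / t%:R) +
      24 / S%:R ^+ 2 * (S%:R / t%:R + (S%:R / t%:R) ^+ 2) =
      1 - t%:R^-1 * (6 - 24 * S%:R^-1 - 24 * t%:R^-1) :> R.
    by field; rewrite tn0 Sn0.
  rewrite lerD2l lerN2 mulrC ler_wpM2l ?invr_ge0 //.
  have : S%:R^-1 <= 48^-1 :> R by rewrite lef_pV2 ?posrE.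
  have : t%:R^-1 <= 48^-1 :> R by rewrite lef_pV2 ?posrE.
  lra.
rewrite /k mulrAC ler_wpM2r ?invr_ge0 ?exprn_ge0 //.
have -> : 1 - 5 / t%:R = (t%:R - 5) / t%:R :> R by field.
rewrite mulrA ler_pdivrMr // -exprSr -natr1 -subr_ge0.
set x : R := t%:R in t0 *.
have -> : x ^+ 6 - (x + 1) ^+ 5 * (x - 5) =
    15 * x ^+ 4 + 40 * x ^+ 3 + 45 * x ^+ 2 + 24 * x + 5 by ring.
have x0 := ltW t0.
have := exprn_ge0 2 x0; have := exprn_ge0 3 x0; have := exprn_ge0 4 x0; lra.
Qed.

(** The product is at most exp (- m), and exp (m / 3) >= m / 3. *)
Lemma prod_compl_le (I : finType) (p : I -> R) (m : R) :
  (forall u, 0 <= p u <= 1) -> \sum_u p u = m -> 0 < m ->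
  \prod_u (1 - p u) <= 27 / m ^+ 3.
Proof.
move=> p01 pm m0.
apply: (@le_trans _ _ (expR (- m))).
  rewrite -pm -sumrN expR_sum; apply: ler_prod => u _.
  by have /andP[? ?] := p01 u; rewrite subr_ge0; apply/andP; split => //;
    exact: expR_ge1Dx.
rewrite expRN -[X in X <= _]mul1r ler_pdivrMr ?expR_gt0 // mulrAC.
rewrite ler_pdivlMr ?exprn_gt0 // mul1r.
have -> : expR m = expR (m / 3) ^+ 3.
  by rewrite -expRM_natr; congr expR; field.
have -> : m ^+ 3 = 27 * (m / 3) ^+ 3 by field.
rewrite ler_wpM2l // lerXn2r ?nnegrE ?expR_ge0 //; first by rewrite divr_ge0 // ltW.
by apply: le_trans (expR_ge1Dx _); rewrite lerDr.
Qed.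

(** Telescoping, from 1/t^2 <= 2 (1/t - 1/(t+1)). *)
Lemma sum_inv_sqr_le (s n : nat) : (0 < s)%N ->
  \sum_(i < n) ((s + i)%:R ^+ 2)^-1 <= 2 * (s%:R^-1 - (s + n)%:R^-1) :> R.
Proof.
move=> s0; elim: n => [|n IH]; first by rewrite big_ord0 addn0 subrr mulr0.
rewrite big_ord_recr /=; apply: le_trans (lerD IH (lexx _)) _.
rewrite addnS -(natr1 (s + n)%N); set x : R := (s + n)%:R.
have x1 : 1 <= x by rewrite ler1n addn_gt0 s0.
have x0 : 0 < x by lra.
have x10 : 0 < x + 1 by lra.
clearbody x.
rewrite -subr_ge0.
have -> : 2 * (s%:R^-1 - (x + 1)^-1) - (2 * (s%:R^-1 - x^-1) + (x ^+ 2)^-1) =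
   (x - 1) / (x ^+ 2 * (x + 1)).
  by field; rewrite !gt_eqF // ltr0n.
by rewrite divr_ge0 ?subr_ge0 // mulr_ge0 ?exprn_ge0 // ltW.
Qed.

End Potentials.

(** * Degrees and complements *)

Lemma deg_sum t (g : rel nat) u : deg t g u = (\sum_(v < t.+1) g u v)%N.
Proof. by rewrite /deg -sum1_card big_mkcond /=; apply: eq_bigr => v _; rewrite inE; case: (g u v). Qed.

Lemma deg_le t (g : sgraph nat) u : (u <= t)%N -> (deg t g u <= t)%N.
Proof.
rewrite -ltnS => ut; rewrite /deg.
apply: (@leq_trans #|predC1 (Ordinal ut)|).
  apply/subset_leq_card/fintype.subsetP => v; rewrite !inE; apply: contraTneq => ->.
  by rewrite /= adj_irr.
by rewrite cardC1 card_ord.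
Qed.

Lemma deg_gt0 t (g : rel nat) u v : (v <= t)%N -> g u v -> (0 < deg t g u)%N.
Proof.
rewrite -ltnS => vt guv; apply/card_gt0P; exists (Ordinal vt).
by rewrite inE.
Qed.

Lemma deg_lt t (g : sgraph nat) u v : (u <= t)%N -> (v <= t)%N -> v != u ->
  ~~ g u v -> (deg t g u < t)%N.
Proof.
rewrite -ltnS -(ltnS v) => ut vt vu guv; rewrite /deg.
apply: (@leq_trans #|predC1 (Ordinal ut)|); last by rewrite cardC1 card_ord.
apply/proper_card/fintype.properP; split.
  apply/fintype.subsetP => x; rewrite !inE; apply: contraTneq => ->.
  by rewrite /= adj_irr.
by exists (Ordinal vt); rewrite inE.
Qed.

Section Complement.
Variables (V : eqType) (A : pred V) (g : sgraph V).

(** Complement within the vertex set [A]; pairs that leave [A] stay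
    non-adjacent, as the graphs of the process are supported on an initial
    segment. *)
Definition compl_adj (u v : V) : bool := [&& A u, A v, u != v & ~~ g u v].

Lemma compl_adj_sym : symmetric compl_adj.
Proof.
by move=> u v; rewrite /compl_adj eq_sym (adj_sym g u v); case: (A u); case: (A v).
Qed.

Lemma compl_adj_irr : irreflexive compl_adj.
Proof. by move=> u; rewrite /compl_adj eqxx !andbF. Qed.

Definition compl_graph : sgraph V := SGraph compl_adj_sym compl_adj_irr.

End Complement.

Lemma deg_compl t (g : sgraph nat) u : (u <= t)%N ->
  deg t (compl_graph (fun v => (v <= t)%N) g) u = (t - deg t g u)%N.
Proof.
move=> ut; have ut1 : (u < t.+1)%N by [].
have : (deg t (compl_graph (fun v => (v <= t)%N) g) u + deg t g u = t)%N.
  transitivity #|predC1 (Ordinal ut1)|; last by rewrite cardC1 card_ord.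
  rewrite !deg_sum -big_split /= -sum1_card [RHS]big_mkcond.
  apply: eq_bigr => v _; rewrite /compl_adj !inE ut -ltnS ltn_ord /= eq_sym.
  rewrite -val_eqE /=; case: eqVneq => [->|_]; first by rewrite adj_irr.
  by case: (g u v).
by move=> h; rewrite -[X in (X - _)%N]h addnK.
Qed.

(** * The process as a Markov chain on finite graphs *)

Section Process.
Variables (R : realType) (d : measure_display) (T : measurableType d).
Variables (P : probability T R) (v' : nat) (G' : sgraph 'I_v'.+1).
Variable G : nat -> T -> sgraph nat.
Hypothesis hG : preferential_attachment P G' G.

Lemma pa_edge_le t w u v : (v' <= t)%N -> G t w u v -> (u <= t)%N /\ (v <= t)%N.
Proof. by move=> vt /(pa_support hG); move/maxn_idPr: vt => -> /andP. Qed.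

Lemma pa_stable s t w u v : (v' <= s)%N -> (s <= t)%N -> (u <= s)%N ->
  (v <= s)%N -> G t w u v = G s w u v.
Proof.
move=> vs /subnKC <- us ws; elim: (t - s)%N => [|k IH]; first by rewrite addn0.
by rewrite addnS (pa_step hG) ?IH //; lia.
Qed.

Definition same t w w' := forall u v, G t w u v = G t w' u v.

(** The graph at time [t] determines all earlier ones, so conditioning on the
    history amounts to conditioning on the present graph. *)
Lemma same_le s t w w' : (v' <= t)%N -> (s <= t)%N -> same t w w' -> same s w w'.
Proof.
move=> vt st h u v.
case: (leqP s v') => sv.
  case: (leqP u v') => uv; last first.
    by apply/idP/idP => /(pa_support hG); rewrite (maxn_idPl sv) leqNgt uv.
  case: (leqP v v') => vv; last first.
    by apply/idP/idP => /(pa_support hG); rewrite (maxn_idPl sv) andbC leqNgt vv.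
  have := pa_init hG w (Ordinal (uv : u < v'.+1)%N) (Ordinal (vv : v < v'.+1)%N) sv.
  have := pa_init hG w' (Ordinal (uv : u < v'.+1)%N) (Ordinal (vv : v < v'.+1)%N) sv.
  by move=> /= -> ->.
have vs := ltnW sv.
case: (leqP u s) => us; last first.
  by apply/idP/idP => /(pa_edge_le vs)[]; rewrite leqNgt us.
case: (leqP v s) => ws; last first.
  by apply/idP/idP => /(pa_edge_le vs)[_]; rewrite leqNgt ws.
by rewrite -!(pa_stable _ vs st us ws) h.
Qed.

(** Measurability with respect to the history up to time [t], stated without
    sigma-algebras: the history takes finitely many values. *)
Definition adapted (X : Type) t (F : T -> X) :=
  forall w w', same t w w' -> F w = F w'.

Lemma adapted_le X s t (F : T -> X) : (v' <= t)%N -> (s <= t)%N ->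
  adapted s F -> adapted t F.
Proof. by move=> vt st h w w' /(same_le vt st) /h. Qed.

Lemma adapted_deg s t u : (v' <= t)%N -> (s <= t)%N ->
  adapted t (fun w => deg s (G s w) u).
Proof.
by move=> vt st w w' /(same_le vt st) h; apply: eq_card => v; rewrite !inE h.
Qed.

(** The finitely many possible values of the graph at time [t]; the fibres of
    [code t] are the atoms of the history. *)
Definition code t w : {ffun 'I_t.+1 * 'I_t.+1 -> bool} :=
  [ffun ij : 'I_t.+1 * 'I_t.+1 => G t w ij.1 ij.2].

Lemma codeP t w w' : (v' <= t)%N -> code t w = code t w' <-> same t w w'.
Proof.
move=> vt; split=> [/ffunP h u v|h]; last first.
  by apply/ffunP => -[i j]; rewrite !ffunE h.
case: (leqP u t) => us; last first.
  by apply/idP/idP => /(pa_edge_le vt)[]; rewrite leqNgt us.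
case: (leqP v t) => ws; last first.
  by apply/idP/idP => /(pa_edge_le vt)[_]; rewrite leqNgt ws.
by have := h (Ordinal (us : u < t.+1)%N, Ordinal (ws : v < t.+1)%N); rewrite !ffunE.
Qed.

Lemma measurable_code t x : measurable [set w | code t w = x].
Proof.
have -> : [set w | code t w = x] =
    \bigcap_(ij in [set: 'I_t.+1 * 'I_t.+1]) [set w | G t w ij.1 ij.2 = x ij].
  apply/seteqP; split => [w <- ij _ /=|w h]; first by rewrite ffunE.
  by apply/ffunP => ij; rewrite ffunE; exact: h.
apply: fin_bigcap_measurable => // ij _.
have h := pa_measurable hG t ij.1 ij.2.
case: (x ij); first exact: h.
have -> : [set w | G t w ij.1 ij.2 = false] = ~` [set w | G t w ij.1 ij.2].
  by apply/seteqP; split => w /= => [->//|/negP/negbTE].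
exact: measurableC.
Qed.

Lemma adapted_measurable t (A : set T) : (v' <= t)%N -> adapted t A ->
  measurable A.
Proof.
move=> vt hA.
have -> : A = \bigcup_(x in [set x | exists2 w, A w & code t w = x])
               [set w | code t w = x].
  apply/seteqP; split => [w Aw|w [x [w' Aw' <-]] /= /(codeP _ _ vt)/hA ->//].
  by exists (code t w) => //; exists w.
by apply: fin_bigcup_measurable => // x _; exact: measurable_code.
Qed.

Lemma adapted_measurable_fun t (F : T -> R) : (v' <= t)%N -> adapted t F ->
  measurable_fun setT (EFin \o F).
Proof.
move=> vt hF _ B mB; rewrite setTI; apply: (adapted_measurable vt) => w w' /hF.
by rewrite /preimage /= => ->.
Qed.

Definition Ex (f : T -> R) : \bar R := (\int[P]_w (f w)%:E)%E.

Lemma Ex_eq f g : f =1 g -> Ex f = Ex g.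
Proof. by move=> h; apply: eq_integral => w _; rewrite h. Qed.

Lemma Ex_indic t (A : T -> bool) : (v' <= t)%N -> adapted t A ->
  Ex (fun w => (A w)%:R) = P [set w | A w].
Proof.
move=> vt hA; rewrite /Ex.
have mA : measurable [set w | A w].
  by apply: (adapted_measurable vt) => w w' /hA e; rewrite /= e.
rewrite -[in RHS](setIT [set w | A w]) -integral_indic //.
apply: eq_integral => w _; rewrite indicE; congr (((_ : bool)%:R)%:E).
by apply/idP/idP; rewrite inE.
Qed.

Lemma Ex_le t f g : (v' <= t)%N -> adapted t f -> adapted t g ->
  (forall w, 0 <= f w) -> (forall w, f w <= g w) -> (Ex f <= Ex g)%E.
Proof.
move=> vt hf hg f0 fg; apply: ge0_le_integral => //.
- by move=> w _; rewrite lee_fin.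
- exact: adapted_measurable_fun hf.
- exact: adapted_measurable_fun hg.
- by move=> w _; rewrite lee_fin.
Qed.

Lemma ExD t f g : (v' <= t)%N -> adapted t f -> adapted t g ->
  (forall w, 0 <= f w) -> (forall w, 0 <= g w) ->
  Ex (fun w => f w + g w) = (Ex f + Ex g)%E.
Proof.
move=> vt hf hg f0 g0; rewrite /Ex -ge0_integralD //.
- by move=> w _; rewrite lee_fin.
- exact: adapted_measurable_fun hf.
- by move=> w _; rewrite lee_fin.
- exact: adapted_measurable_fun hg.
Qed.

Lemma ExZ t (c : R) f : (v' <= t)%N -> adapted t f -> 0 <= c ->
  (forall w, 0 <= f w) -> Ex (fun w => c * f w) = (c%:E * Ex f)%E.
Proof.
move=> vt hf c0 f0; rewrite /Ex -ge0_integralZl //.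
- exact: adapted_measurable_fun hf.
- by move=> w _; rewrite lee_fin.
Qed.

Lemma Ex_sum t (J : finType) (f : J -> T -> R) : (v' <= t)%N ->
  (forall j, adapted t (f j)) -> (forall j w, 0 <= f j w) ->
  Ex (fun w => \sum_j f j w) = (\sum_j Ex (f j))%E.
Proof.
move=> vt hf f0; rewrite /Ex -ge0_integral_sum //.
- by apply: eq_integral => w _; rewrite sumEFin.
- by move=> j; exact: adapted_measurable_fun (hf j).
- by move=> j w _; rewrite lee_fin.
Qed.

Definition new_nbrs t w : {set 'I_t.+1} := [set u : 'I_t.+1 | G t.+1 w t.+1 u].

Definition edge_prob t w (u : 'I_t.+1) : R := (deg t (G t w) u)%:R / t%:R.
Arguments edge_prob t w u : clear implicits.

Lemma in_new_nbrs t w (u : 'I_t.+1) : (u \in new_nbrs t w) = G t.+1 w t.+1 u.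
Proof. by rewrite inE. Qed.

Lemma adapted_new_nbrs t : (v' <= t)%N -> adapted t.+1 (new_nbrs t).
Proof. by move=> vt w w' h; apply/setP => u; rewrite !inE h. Qed.

Lemma adapted_code t : (v' <= t)%N -> adapted t (code t).
Proof. by move=> vt w w' /(codeP _ _ vt). Qed.

Lemma adapted_edge_prob t : (v' <= t)%N -> adapted t (edge_prob t).
Proof.
move=> vt w w' h; apply/funext => u; rewrite /edge_prob.
by rewrite (adapted_deg u vt (leqnn t) h).
Qed.

Lemma pa_law_code t w0 (N : {set 'I_t.+1}) : (v' <= t)%N ->
  P [set w | (code t w == code t w0) && (new_nbrs t w == N)] =
  (P [set w | code t w == code t w0] * (bern_wt (edge_prob t w0) N)%:E)%E.
Proof.
move=> vt; have := @pa_law _ _ _ _ _ _ _ hG t (fun s => G s w0) N vt.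
have -> : [set w | forall s u v, (s <= t)%N -> G s w u v = G s w0 u v] =
          [set w | code t w == code t w0].
  apply/seteqP; split => w /= => [h|/eqP/(codeP _ _ vt) h s u v st].
    by apply/eqP/codeP => // u v; exact: h.
  exact: (same_le vt st h).
move=> <-; congr (P _); apply/seteqP; split => w /=.
  by move=> /andP[-> /eqP <-]; split => // u; rewrite in_new_nbrs.
by move=> [-> h] /=; apply/eqP/setP => u; rewrite in_new_nbrs.
Qed.

Hypothesis hv : (1 <= v')%N.

Lemma edge_prob01 t w (u : 'I_t.+1) : (v' <= t)%N -> 0 <= edge_prob t w u <= 1.
Proof.
move=> vt; rewrite /edge_prob divr_ge0 //= ler_pdivrMr ?ltr0n ?(leq_trans hv) //.
by rewrite mul1r ler_nat deg_le // -ltnS.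
Qed.

(** The law of the process is given on the atoms of the history; on each of
    them [H] and the attachment probabilities are constant. *)
Lemma Ex_new t N (H : T -> R) : (v' <= t)%N -> adapted t H ->
  (forall w, 0 <= H w) ->
  Ex (fun w => H w * (new_nbrs t w == N)%:R) =
  Ex (fun w => H w * bern_wt (edge_prob t w) N).
Proof.
move=> vt hH H0; have vt1 := leqW vt.
have ad1 X F : @adapted X t F -> adapted t.+1 F by apply: adapted_le.
have hC x : adapted t (fun w => code t w == x) by move=> w w' /(adapted_code vt) ->.
have hN : adapted t.+1 (fun w => new_nbrs t w == N) by move=> w w' /(adapted_new_nbrs vt) ->.
have hW : adapted t (fun w => bern_wt (edge_prob t w) N).
  by move=> w w' /(adapted_edge_prob vt) ->.
have W0 w : 0 <= bern_wt (edge_prob t w) N.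
  by apply: bern_wt_ge0 => u; exact: edge_prob01.
have cells f : Ex f = Ex (fun w => \sum_x f w * (code t w == x)%:R).
  apply: Ex_eq => w; rewrite (bigD1 (code t w)) //= eqxx mulr1 big1 ?addr0 //.
  by move=> x /negPf; rewrite eq_sym => ->; rewrite mulr0.
rewrite cells [RHS]cells (@Ex_sum t.+1) //; first last.
- by move=> x w; rewrite !mulr_ge0.
- by move=> x w w' h; rewrite (ad1 _ _ hH _ _ h) (hN _ _ h) (ad1 _ _ (hC x) _ _ h).
rewrite (@Ex_sum t) //; first last.
- by move=> x w; rewrite !mulr_ge0.
- by move=> x w w' h; rewrite (hH _ _ h) (hW _ _ h) (hC x _ _ h).
apply: eq_bigr => x _.
have [[w0 w0x]|nx] := pselect (exists w, code t w = x); last first.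
  apply: Ex_eq => w; case: (code t w =P x) => [e|_]; last by rewrite !mulr0.
  by case: nx; exists w.
subst x.
transitivity (Ex (fun w => H w0 * ((code t w == code t w0) && (new_nbrs t w == N))%:R)).
  apply: Ex_eq => w; case: (code t w =P code t w0) => [/(codeP _ _ vt)/hH ->|_] /=; last by rewrite !mulr0.
  by rewrite mulr1.
transitivity (Ex (fun w => H w0 * bern_wt (edge_prob t w0) N
                           * (code t w == code t w0)%:R)); last first.
  apply: Ex_eq => w; case: (code t w =P code t w0) => [/(codeP _ _ vt) h|_] /=; last by rewrite !mulr0.
  by rewrite (hH _ _ h) (hW _ _ h).
have hCN : adapted t.+1 (fun w => (code t w == code t w0) && (new_nbrs t w == N)).
  by move=> w w' h; rewrite (hN _ _ h) (ad1 _ _ (hC _) _ _ h).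
rewrite (@ExZ t.+1) //; last by move=> w w' /hCN ->.
rewrite (@ExZ t) //; first last.
- by rewrite mulr_ge0.
- by move=> w w' /hC ->.
by rewrite (Ex_indic vt1) // (Ex_indic vt) // pa_law_code // EFinM muleA muleAC.
Qed.

(** Conditional expectation given the history: the new neighbourhood is
    averaged out with the Bernoulli weights. *)
Lemma Ex_step t (Phi : T -> {set 'I_t.+1} -> R) : (v' <= t)%N ->
  (forall N, adapted t (Phi ^~ N)) -> (forall w N, 0 <= Phi w N) ->
  Ex (fun w => Phi w (new_nbrs t w)) =
  Ex (fun w => \sum_N bern_wt (edge_prob t w) N * Phi w N).
Proof.
move=> vt hPhi Phi0; have vt1 := leqW vt.
transitivity (Ex (fun w => \sum_N Phi w N * (new_nbrs t w == N)%:R)).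
  apply: Ex_eq => w; rewrite (bigD1 (new_nbrs t w)) //= eqxx mulr1 big1 ?addr0 //.
  by move=> x /negPf; rewrite eq_sym => ->; rewrite mulr0.
rewrite (@Ex_sum t.+1) //; first last.
- by move=> N w; rewrite mulr_ge0.
- move=> N w w' h; rewrite (adapted_new_nbrs vt h).
  by rewrite (adapted_le vt1 (leqnSn t) (hPhi N) h).
rewrite (@Ex_sum t) //; first last.
- by move=> N w; rewrite mulr_ge0 // bern_wt_ge0 // => u; exact: edge_prob01.
- by move=> N w w' h; rewrite (adapted_edge_prob vt h) (hPhi N _ _ h).
apply: eq_bigr => N _; rewrite Ex_new //.
by apply: Ex_eq => w; rewrite mulrC.
Qed.

Lemma Ex_step_le t (Phi : T -> {set 'I_t.+1} -> R) H : (v' <= t)%N ->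
  (forall N, adapted t (Phi ^~ N)) -> (forall w N, 0 <= Phi w N) ->
  adapted t H ->
  (forall w, \sum_N bern_wt (edge_prob t w) N * Phi w N <= H w) ->
  (Ex (fun w => Phi w (new_nbrs t w)) <= Ex H)%E.
Proof.
move=> vt hPhi Phi0 hH le; rewrite Ex_step //; apply: (Ex_le vt) => //.
- move=> w w' h; rewrite (adapted_edge_prob vt h).
  by apply: eq_bigr => N _; rewrite (hPhi N _ _ h).
- move=> w; apply: sumr_ge0 => N _; rewrite mulr_ge0 // bern_wt_ge0 // => u.
  exact: edge_prob01.
Qed.

Lemma deg_step t w (u : 'I_t.+1) : (v' <= t)%N ->
  deg t.+1 (G t.+1 w) u = (deg t (G t w) u + (u \in new_nbrs t w))%N.
Proof.
move=> vt; rewrite !deg_sum big_ord_recr /= in_new_nbrs (adj_sym (G t.+1 w) u t.+1).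
by congr (_ + _)%N; apply: eq_bigr => v _; rewrite (pa_step hG) // -ltnS.
Qed.

Lemma deg_new_nbrs t w : deg t.+1 (G t.+1 w) t.+1 = #|new_nbrs t w|.
Proof.
rewrite deg_sum big_ord_recr /= adj_irr addn0 -sum1_card [RHS]big_mkcond /=.
by apply: eq_bigr => u _; rewrite in_new_nbrs; case: (G _ _ _ _).
Qed.

Definition degsum t w : nat := \sum_(u < t.+1) deg t (G t w) u.

(** Every new edge is counted at both ends. *)
Lemma degsum_step t w : (v' <= t)%N ->
  degsum t.+1 w = (degsum t w + 2 * #|new_nbrs t w|)%N.
Proof.
move=> vt; rewrite /degsum big_ord_recr /= deg_new_nbrs.
under eq_bigr => u _ do rewrite deg_step //.
rewrite big_split /= -addnA mul2n -addnn; congr (_ + (_ + _))%N.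
by rewrite -sum1_card [RHS]big_mkcond; apply: eq_bigr => u _; case: (u \in _).
Qed.

Lemma sum_edge_prob t w : \sum_u edge_prob t w u = (degsum t w)%:R / t%:R.
Proof. by rewrite /edge_prob -mulr_suml natr_sum. Qed.

Lemma Ex_cst (c : R) : Ex (fun=> c) = c%:E.
Proof. by rewrite /Ex integral_cst // [X in (_ * X)%E]probability_setT mule1. Qed.

Lemma negligible_Ex t (A : T -> bool) : (v' <= t)%N -> adapted t A ->
  Ex (fun w => (A w)%:R) = 0%E -> {ae P, forall w, ~~ A w}.
Proof.
move=> vt hA h; exists [set w | A w]; split.
- by apply: (adapted_measurable vt) => w w' /hA e; rewrite /= e.
- by rewrite -(Ex_indic vt hA).
- by move=> w /= /negP; rewrite negbK.
Qed.

(** Isolated vertices are never chosen: this is what keeps an edgeless graph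
    edgeless. *)
Lemma ae_no_edge_deg0 t (u : 'I_t.+1) : (v' <= t)%N ->
  {ae P, forall w, ~~ ((deg t (G t w) u == 0%N) && (u \in new_nbrs t w))}.
Proof.
move=> vt; have vt1 := leqW vt.
have hD : adapted t (fun w => deg t (G t w) u == 0%N).
  by move=> w w' h; rewrite (adapted_deg u vt (leqnn t) h).
apply: (negligible_Ex vt1).
  move=> w w' h; rewrite (adapted_new_nbrs vt h).
  by rewrite (adapted_deg u vt1 (leqnSn t) h).
pose Phi w (N : {set 'I_t.+1}) : R := (deg t (G t w) u == 0%N)%:R * (u \in N)%:R.
transitivity (Ex (fun w => Phi w (new_nbrs t w))).
  by apply: Ex_eq => w; rewrite /Phi -natrM mulnb.
rewrite Ex_step //; first last.
- by move=> w N; rewrite mulr_ge0.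
- by move=> N w w' /hD h; rewrite /Phi h.
transitivity (Ex (fun=> 0)); last exact: Ex_cst.
apply: Ex_eq => w; rewrite /Phi.
under eq_bigr => N _ do rewrite mulrCA.
rewrite -mulr_sumr (bern_mem _ u (fun b => b%:R)) mulr1 mulr0 addr0 /edge_prob.
by case: eqP => [->|_]; rewrite ?mul0r ?mulr0 // mul0r.
Qed.

(** * Adjacency patterns recur *)

Section Pattern.
Variables (s : nat) (D sg : pred nat).
Hypotheses (vs : (v' <= s)%N) (Ds : forall u, D u -> (u <= s)%N).

(** The urn seen from either colour: the degree for [b = true], the number of
    non-neighbours for [b = false]. Both grow with probability proportional to
    their size, so edges and non-edges are treated alike. *)
Definition degb (b : bool) t w u : nat :=
  if b then deg t (G t w) u else (t - deg t (G t w) u)%N.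

Lemma degb_le b t w u : (u <= t)%N -> (degb b t w u <= t)%N.
Proof. by move=> ut; rewrite /degb; case: b; rewrite ?leq_subr ?deg_le. Qed.

Lemma adapted_degb b t u : (v' <= t)%N -> adapted t (fun w => degb b t w u).
Proof. by move=> vt w w' h; rewrite /degb (adapted_deg u vt (leqnn t) h). Qed.

Lemma degb_step b t w (u : 'I_t.+1) : (v' <= t)%N ->
  degb b t.+1 w u = (degb b t w u + ((u \in new_nbrs t w) == b))%N.
Proof.
move=> vt; rewrite /degb deg_step //.
have : (deg t (G t w) u <= t)%N by rewrite deg_le // -ltnS.
by case: b; case: (u \in _) => /= h; lia.
Qed.

Lemma degb_prob b t w (u : 'I_t.+1) : (v' <= t)%N ->
  (if b then edge_prob t w u else 1 - edge_prob t w u) =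
  (degb b t w u)%:R / t%:R.
Proof.
move=> vt; rewrite /degb /edge_prob; case: b => //.
rewrite natrB ?deg_le // -1?ltnS // mulrBl divff // pnatr_eq0 -lt0n.
exact: leq_trans hv vt.
Qed.

Definition matches t w : bool :=
  [forall u : 'I_t.+1, D u ==> ((u \in new_nbrs t w) == sg u)].

Definition alive w : bool :=
  [forall u : 'I_s.+1, D u ==> (0 < degb (sg u) s w u)%N].

(** No pattern has occurred in the first [n] steps after time [s], from a
    start where none of the urns has lost the colour prescribed to it. *)
Fixpoint unmatched n w : bool :=
  if n is m.+1 then unmatched m w && ~~ matches (s + m) w else alive w.

Definition pot t w : R :=
  \sum_(u < t.+1 | D u) urn_pot R t (degb (sg u) t w u).

Lemma vsD n : (v' <= s + n)%N. Proof. exact: leq_trans (leq_addr _ _). Qed.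

Lemma adapted_unmatched n : adapted (s + n) (unmatched n).
Proof.
elim: n => [|n IH] w w' h.
  rewrite addn0 in h; apply: eq_forallb => u.
  by rewrite (adapted_degb (sg u) u vs h).
rewrite addnS in h.
rewrite /= (adapted_le (leqW (vsD n)) (leqnSn _) IH h).
by rewrite /matches (adapted_new_nbrs (vsD n) h).
Qed.

Lemma adapted_pot t : (v' <= t)%N -> adapted t (pot t).
Proof.
move=> vt w w' h; apply: eq_bigr => u _.
by rewrite (adapted_degb (sg u) u vt h).
Qed.

Lemma pot_ge0 t w : 0 <= pot t w.
Proof. by apply: sumr_ge0 => u _; exact: urn_pot_ge0. Qed.

Lemma unmatched_alive n w (u : nat) : unmatched n w -> D u ->
  (0 < degb (sg u) (s + n) w u)%N.
Proof.
move=> h Du; have : alive w by elim: n h => //= n IH /andP[/IH].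
move=> /forallP al; have us := Ds Du.
elim: n {h} => [|n IH].
  by have := al (Ordinal (us : u < s.+1)%N); rewrite /= Du addn0.
have un : (u < (s + n).+1)%N by rewrite ltnS (leq_trans us) // leq_addr.
rewrite addnS -[u]/(nat_of_ord (Ordinal un)) degb_step ?vsD // ltn_addr //.
Qed.

Lemma pot_stepE t w : (s <= t)%N ->
  pot t.+1 w = \sum_(u < t.+1 | D u)
     urn_pot R t.+1 (degb (sg u) t w u + ((u \in new_nbrs t w) == sg u)).
Proof.
move=> st; rewrite /pot big_mkcond big_ord_recr /=.
have -> : D t.+1 = false by apply/negP => /Ds; rewrite leqNgt ltnS st.
rewrite addr0 [RHS]big_mkcond; apply: eq_bigr => u _.
by rewrite degb_step // (leq_trans vs).
Qed.

(** A sum of martingales, one for each vertex of [D]. *)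
Lemma pot_step n w : unmatched n w -> let t := (s + n)%N in
  \sum_N bern_wt (edge_prob t w) N * (\sum_(u < t.+1 | D u)
     urn_pot R t.+1 (degb (sg u) t w u + ((u \in N) == sg u))) = pot t w.
Proof.
move=> h /=; set t := (s + n)%N; have vt : (v' <= t)%N := vsD n.
under eq_bigr => N _ do rewrite mulr_sumr.
rewrite exchange_big /=; apply: eq_bigr => u Du.
rewrite (bern_mem _ u (fun b => urn_pot R t.+1 (degb (sg u) t w u + (b == sg u)))).
have ut : (u <= t)%N by rewrite -ltnS.
have h0 : (0 < degb (sg u) t w u <= t)%N.
  by rewrite degb_le // andbT unmatched_alive.
rewrite -[RHS](urn_pot_step R h0) -degb_prob //.
by case: (sg u) => /=; rewrite addn0 addn1; ring.
Qed.

Lemma Ex_pot_le n :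
  (Ex (fun w => (unmatched n w)%:R * pot (s + n) w)%R <= (s.+1 * s)%:R%:E)%E.
Proof.
elim: n => [|n IH].
  rewrite addn0 -Ex_cst; apply: (Ex_le vs) => [w w' h|//|w|w].
  - rewrite (adapted_pot vs h); congr ((_ : bool)%:R * _).
    by apply: adapted_unmatched; rewrite addn0.
  - by rewrite mulr_ge0 ?pot_ge0.
  case: (boolP (unmatched 0 w)) => [h|_]; last by rewrite mul0r.
  rewrite mul1r /pot big_mkcond /= natrM -[X in X%:R * _]card_ord -sumr_const.
  rewrite mulr_suml; apply: ler_sum => u _; case: ifP => [Du|_]; last by rewrite mul1r.
  rewrite mul1r; apply: urn_pot_le.
  by move: (forallP h u); rewrite Du.
apply: le_trans IH; set t := (s + n)%N.
have vt : (v' <= t)%N := vsD n.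
have vt1 := leqW vt.
have hU := @adapted_unmatched n.
pose Phi w (N : {set 'I_t.+1}) : R := (unmatched n w)%:R * (\sum_(u < t.+1 | D u)
     urn_pot R t.+1 (degb (sg u) t w u + ((u \in N) == sg u))).
have Phi0 w N : 0 <= Phi w N.
  by rewrite mulr_ge0 // sumr_ge0 // => u _; exact: urn_pot_ge0.
have hPhi N : adapted t (Phi ^~ N).
  move=> w w' h; rewrite /Phi (hU _ _ h); congr (_ * _).
  by apply: eq_bigr => u _; rewrite (adapted_degb (sg u) u vt h).
apply: (@le_trans _ _ (Ex (fun w => Phi w (new_nbrs t w)))).
  rewrite addnS; apply: (Ex_le vt1).
  - move=> w w' h; rewrite (adapted_pot vt1 h); congr ((_ : bool)%:R * _).
    by apply: adapted_unmatched; rewrite addnS.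
  - move=> w w' h; rewrite (adapted_new_nbrs vt h).
    exact: (adapted_le vt1 (leqnSn t) (hPhi _)).
  - by move=> w; rewrite mulr_ge0 ?pot_ge0.
  - move=> w; rewrite /Phi -pot_stepE ?leq_addr // ler_wpM2r ?pot_ge0 //=.
    by rewrite ler_nat; case: (unmatched n w) => //=; case: matches.
apply: Ex_step_le => //.
  by move=> w w' h; rewrite (adapted_pot vt h) (hU _ _ h).
move=> w; under eq_bigr => N _ do rewrite mulrCA.
rewrite -mulr_sumr; case: (boolP (unmatched n w)) => [h|_]; last by rewrite !mul0r.
by rewrite pot_step.
Qed.

(** By independence the probability is the product of the proportions, and
    each of these is at least the exponential of minus its potential. *)
Lemma matches_prob n w : unmatched n w -> let t := (s + n)%N in
  expR (- pot t w) <=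
  \sum_N bern_wt (edge_prob t w) N *
    [forall u : 'I_t.+1, D u ==> ((u \in N) == sg u)]%:R.
Proof.
move=> h /=; set t := (s + n)%N; have vt : (v' <= t)%N := vsD n.
rewrite (bern_pattern _ (fun u : 'I_t.+1 => D u) (fun u : 'I_t.+1 => sg u)) -sumrN expR_sum.
apply: ler_prod => u Du; rewrite expR_ge0 /= degb_prob //.
have ut : (u <= t)%N by rewrite -ltnS.
have h0 : (0 < degb (sg u) t w u <= t)%N.
  by rewrite degb_le // andbT unmatched_alive.
have t0 : 0 < t%:R :> R by rewrite ltr0n (leq_trans hv).
rewrite ler_pdivlMr // mulrC expRN ler_pdivrMr ?expR_gt0 //.
exact: le_expR_urn_pot.
Qed.

(** If the total potential is at most [C] the pattern occurs with probability
    at least [expR (- C)]. The event that it is larger has probability at most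
    the mean potential over [C]; writing this as a pointwise linear bound on
    the probability of no match avoids any maximal inequality. *)
Lemma Ex_unmatched_step n (C : R) : 0 < C ->
  (Ex (fun w => (unmatched n.+1 w)%:R)%R <=
   (1 - expR (- C))%:E * Ex (fun w => (unmatched n w)%:R)%R +
   (expR (- C) * ((s.+1 * s)%:R / C))%:E)%E.
Proof.
move=> C0; set t := (s + n)%N; set c := expR (- C).
have c0 : 0 < c by exact: expR_gt0.
have c1 : c <= 1 by rewrite -expR0 ler_expR lerNl oppr0 ltW.
have vt : (v' <= t)%N := vsD n.
have hU : adapted t (fun w => (unmatched n w)%:R : R).
  by move=> w w' /adapted_unmatched ->.
have hUp : adapted t (fun w => (unmatched n w)%:R * pot t w).
  by move=> w w' h; rewrite (hU _ _ h) (adapted_pot vt h).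
pose Phi w (N : {set 'I_t.+1}) : R := (unmatched n w)%:R *
   (~~ [forall u : 'I_t.+1, D u ==> ((u \in N) == sg u)])%:R.
have -> : Ex (fun w => (unmatched n.+1 w)%:R) = Ex (fun w => Phi w (new_nbrs t w)).
  by apply: Ex_eq => w; rewrite /= /Phi -natrM mulnb.
apply: (@le_trans _ _ (Ex (fun w => (1 - c) * (unmatched n w)%:R +
           c / C * ((unmatched n w)%:R * pot t w)))).
  apply: Ex_step_le => //.
  - by move=> N w w' h; rewrite /Phi (hU _ _ h).
  - by move=> w N; rewrite mulr_ge0.
  - by move=> w w' h; rewrite (hUp _ _ h) (hU _ _ h).
  move=> w; under eq_bigr => N _ do rewrite mulrCA.
  rewrite -mulr_sumr; case: (boolP (unmatched n w)) => [h|_]; last first.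
    by rewrite !mul0r !mulr0 addr0.
  rewrite !mul1r mulr1.
  have -> : \sum_N bern_wt (edge_prob t w) N *
      (~~ [forall u : 'I_t.+1, D u ==> ((u \in N) == sg u)])%:R =
    1 - \sum_N bern_wt (edge_prob t w) N *
      [forall u : 'I_t.+1, D u ==> ((u \in N) == sg u)]%:R :> R.
    rewrite -[X in X - _](bern_total (edge_prob t w)) -sumrB; apply: eq_bigr => N _.
    by case: [forall u, _] => /=; ring.
  apply: (@le_trans _ _ (1 - expR (- pot t w))).
    by rewrite lerD2l lerN2; exact: matches_prob.
  have p0 := pot_ge0 t w.
  (* If the potential exceeds C, the right-hand side is at least 1. *)
  case: (leP (pot t w) C) => pC.
    have : c <= expR (- pot t w) by rewrite ler_expR lerN2.
    have : 0 <= c / C * pot t w by rewrite mulr_ge0 // divr_ge0 // ltW.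
    lra.
  have : c <= c / C * pot t w.
    by rewrite mulrAC ler_pdivlMr // ler_wpM2l // ltW.
  have := expR_ge0 (- pot t w); lra.
have c1' : 0 <= 1 - c by rewrite subr_ge0.
have cC : 0 <= c / C by rewrite divr_ge0 // ltW.
rewrite (ExD vt); first last.
- by move=> w; rewrite mulr_ge0 // mulr_ge0 ?pot_ge0.
- by move=> w; rewrite mulr_ge0.
- by move=> w w' /hUp ->.
- by move=> w w' /hU ->.
rewrite (ExZ vt hU) // (ExZ vt hUp) //; last by move=> w; rewrite mulr_ge0 ?pot_ge0.
rewrite leeD2l // mulrA mulrAC [in leRHS]EFinM lee_wpmul2l ?lee_fin //.
exact: Ex_pot_le.
Qed.

Lemma Ex_unmatched_le n (C : R) : 0 < C ->
  (Ex (fun w => (unmatched n w)%:R)%R <=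
   ((1 - expR (- C)) ^+ n + (s.+1 * s)%:R / C)%:E)%E.
Proof.
move=> C0; set c := expR (- C); set m := _ / C.
have c1 : c <= 1 by rewrite -expR0 ler_expR lerNl oppr0 ltW.
have m0 : 0 <= m by rewrite divr_ge0 // ltW.
elim: n => [|n IH].
  rewrite -Ex_cst; apply: (Ex_le vs) => // [w w' h|w].
    by congr ((_ : bool)%:R); apply: adapted_unmatched; rewrite addn0.
  by rewrite expr0 (le_trans (y := 1)) ?lerDl // -[1]/(1%:R) ler_nat leq_b1.
apply: (le_trans (Ex_unmatched_step n C0)); rewrite -/c -/m.
apply: (@le_trans _ _ ((1 - c)%:E * ((1 - c) ^+ n + m)%:E + (c * m)%:E)%E).
  by rewrite leeD2r // lee_wpmul2l // lee_fin subr_ge0.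
by rewrite -EFinM -EFinD lee_fin exprS; nra.
Qed.

(** In the bound [Ex_unmatched_le] let first [n] and then [C] tend to
    infinity. *)
Lemma ae_matches :
  {ae P, forall w, alive w -> exists n, matches (s + n) w}.
Proof.
pose B n := [set w | unmatched n w].
have mB n : measurable (B n).
  apply: (adapted_measurable (vsD n)) => w w' h.
  by rewrite /B /= (adapted_unmatched h).
exists (\bigcap_n B n); split.
- exact: bigcapT_measurable.
- apply/eqP; rewrite eq_le measure_ge0 andbT.
  rewrite -(@fineK _ (P _)) ?fin_num_measure //; last exact: bigcapT_measurable.
  set x := fine _; rewrite lee_fin.
  have hx n (C : R) : 0 < C -> x <= (1 - expR (- C)) ^+ n + (s.+1 * s)%:R / C.
    move=> C0; rewrite -lee_fin; apply: le_trans (Ex_unmatched_le n C0).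
    rewrite (Ex_indic (vsD n)); last exact: adapted_unmatched.
    rewrite fineK ?fin_num_measure //; last exact: bigcapT_measurable.
    apply: le_measure; rewrite ?inE; [exact: bigcapT_measurable|exact: mB|].
    by move=> w /(_ n Logic.I).
  have hx' (C : R) : 0 < C -> x <= (s.+1 * s)%:R / C.
    move=> C0; set y := _ / C.
    have : (fun n => (1 - expR (- C)) ^+ n + y) @ \oo --> 0 + y.
      apply: cvgD; last exact: cvg_cst.
      have c0 := expR_gt0 (- C).
      have c1 : expR (- C) < 1 by rewrite -expR0 ltr_expR ltrNl oppr0.
      by apply: cvg_expr; rewrite ger0_norm; lra.
    rewrite add0r => h; rewrite -(cvg_lim _ h) //; apply: limr_ge.
      exact: cvgP h.
    by apply: nearW => n; exact: hx.
  rewrite leNgt; apply/negP => x0.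
  (* A value of C for which the limiting bound is below x / 2. *)
  have k0 : 0 < 2 * ((s.+1 * s)%:R + 1) / x :> R.
    by rewrite divr_gt0 // mulr_gt0 // ltr_wpDl.
  have := hx' _ k0; set m : R := _%:R.
  have m0 : 0 <= m by [].
  rewrite invf_div mulrA ler_pdivlMr ?mulr_gt0 ?ltr_wpDl //.
  nra.
- move=> w /= /not_implyP[al h] n _; rewrite /B /=.
  elim: n => //= n ->; apply/negP => hn; apply: h; by exists n.
Qed.

End Pattern.
(** * Only finitely many vertices are born isolated *)

Lemma adapted_degsum t : (v' <= t)%N -> adapted t (degsum t).
Proof.
by move=> vt w w' h; apply: eq_bigr => u _; exact: adapted_deg (leqnn t) _ _ h.
Qed.

Lemma degsum_le s t w : (v' <= s)%N -> (s <= t)%N -> (degsum s w <= degsum t w)%N.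
Proof.
move=> vs /subnKC <-; elim: (t - s)%N => [|n IH]; first by rewrite addn0.
by rewrite addnS degsum_step ?(leq_trans vs) ?leq_addr // (leq_trans IH) ?leq_addr.
Qed.

Section IsolatedBirths.
Variable s : nat.
Hypotheses (vs : (v' <= s)%N) (s48 : (48 <= s)%N).

(** The threshold from which [bern_cube_step] applies. *)
Definition edge_rich w : bool := (48 <= degsum s w)%N.

Lemma adapted_edge_rich n : adapted (s + n) edge_rich.
Proof.
apply: (adapted_le _ (leq_addr _ _)); first exact: leq_trans (leq_addr _ _).
by move=> w w' h; rewrite /edge_rich (adapted_degsum vs h).
Qed.

(** A supermartingale on the event [edge_rich]; its smallness forces the sum
    of the degrees to grow faster than the time. *)
Definition sparsity t w : R := t%:R ^+ 5 / (degsum t w)%:R ^+ 3.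

Lemma sparsity_ge0 t w : 0 <= sparsity t w.
Proof. by rewrite divr_ge0 ?exprn_ge0. Qed.

Lemma adapted_sparsity n :
  adapted (s + n) (fun w => (edge_rich w)%:R * sparsity (s + n) w).
Proof.
move=> w w' h; rewrite (adapted_edge_rich h) /sparsity.
by rewrite (adapted_degsum _ h) // (leq_trans vs) ?leq_addr.
Qed.

Lemma Ex_sparsity_le n :
  (Ex (fun w => (edge_rich w)%:R * sparsity (s + n) w)%R <= (s%:R ^+ 5)%:E)%E.
Proof.
elim: n => [|n IH].
  rewrite -Ex_cst; apply: (@Ex_le (s + 0)).
  - by rewrite addn0.
  - exact: adapted_sparsity.
  - by [].
  - by move=> w; rewrite mulr_ge0 ?sparsity_ge0.
  move=> w; case: (boolP (edge_rich w)) => [h|_]; last by rewrite mul0r exprn_ge0.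
  rewrite mul1r /sparsity addn0 ler_pdivrMr; last first.
    by rewrite exprn_gt0 // ltr0n (leq_trans _ h).
  by rewrite ler_peMr ?exprn_ge0 // exprn_ege1 // ler1n (leq_trans _ h).
apply: le_trans IH; set t := (s + n)%N.
have vt : (v' <= t)%N by rewrite (leq_trans vs) ?leq_addr.
pose Phi w (N : {set 'I_t.+1}) : R := (edge_rich w)%:R *
   (t.+1%:R ^+ 5 / (degsum t w + 2 * #|N|)%:R ^+ 3).
rewrite (_ : Ex _ = Ex (fun w => Phi w (new_nbrs t w))); last first.
  by apply: Ex_eq => w; rewrite /Phi addnS /sparsity degsum_step.
apply: Ex_step_le => //.
- by move=> N w w' h; rewrite /Phi (adapted_edge_rich h) (adapted_degsum vt h).
- by move=> w N; rewrite mulr_ge0 // divr_ge0 ?exprn_ge0.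
- exact: adapted_sparsity.
move=> w; under eq_bigr => N _ do rewrite mulrCA.
rewrite -mulr_sumr; case: (boolP (edge_rich w)) => [h|_]; last by rewrite !mul0r.
rewrite !mul1r; apply: bern_cube_step.
- by move=> u; exact: edge_prob01.
- by rewrite (leq_trans s48) ?leq_addr.
- by rewrite (leq_trans h) ?degsum_le ?leq_addr.
- exact: sum_edge_prob.
Qed.

Lemma adapted_isolated n :
  adapted (s + n).+1 (fun w => edge_rich w && (new_nbrs (s + n) w == finset.set0)).
Proof.
have vt : (v' <= s + n)%N by rewrite (leq_trans vs) ?leq_addr.
move=> w w' h; rewrite (adapted_new_nbrs vt h).
by rewrite (adapted_le (leqW vt) (leqnSn _) (@adapted_edge_rich n) h).
Qed.

(** Given the history the probability is the product of the [1 - edge_prob t w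
    u], at most 27 (t/S)^3, and this is a multiple of [sparsity t w] by
    27/t^2. *)
Lemma prob_isolated_le n :
  (P [set w | edge_rich w && (new_nbrs (s + n) w == finset.set0)] <=
   (27 * s%:R ^+ 5 * ((s + n)%:R ^+ 2)^-1)%:E)%E.
Proof.
set t := (s + n)%N.
have vt : (v' <= t)%N by rewrite (leq_trans vs) ?leq_addr.
have t0 : 0 < t%:R :> R by rewrite ltr0n (leq_trans hv).
have hD : adapted t (fun w => (edge_rich w)%:R : R).
  by move=> w w' /adapted_edge_rich ->.
have c0 : 0 <= 27 / t%:R ^+ 2 :> R by rewrite divr_ge0 ?exprn_ge0 ?ltW.
have S0 w : 0 <= (edge_rich w)%:R * sparsity t w by rewrite mulr_ge0 ?sparsity_ge0.
rewrite -(Ex_indic (leqW vt)); last exact: adapted_isolated.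
rewrite (_ : Ex _ = Ex (fun w => (edge_rich w)%:R * (new_nbrs t w == finset.set0)%:R)); last first.
  by apply: Ex_eq => w; rewrite -natrM mulnb.
rewrite Ex_new //.
apply: (@le_trans _ _ (Ex (fun w => 27 / t%:R ^+ 2 * ((edge_rich w)%:R * sparsity t w)))).
  apply: (Ex_le vt).
  - by move=> w w' h; rewrite (hD _ _ h) (adapted_edge_prob vt h).
  - by move=> w w' h; rewrite (adapted_sparsity h).
  - move=> w; rewrite mulr_ge0 // bern_wt_ge0 // => u; exact: edge_prob01.
  move=> w; case: (boolP (edge_rich w)) => [h|_]; last by rewrite !mul0r mulr0.
  rewrite !mul1r /bern_wt (eq_bigr (fun u => 1 - edge_prob t w u)); last first.
    by move=> u _; rewrite finset.inE.
  have S0' : 0 < (degsum t w)%:R :> R.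
    rewrite ltr0n (@leq_trans 48) // (leq_trans h) // degsum_le ?leq_addr //.
  apply: le_trans (prod_compl_le _ (sum_edge_prob t w) _) _.
  - by move=> u; exact: edge_prob01.
  - by rewrite divr_gt0.
  rewrite le_eqVlt /sparsity; apply/orP; left; apply/eqP.
  by field; rewrite !gt_eqF.
rewrite (ExZ vt (@adapted_sparsity n)) //.
apply: (@le_trans _ _ ((27 / t%:R ^+ 2)%:E * (s%:R ^+ 5)%:E)%E).
  by rewrite lee_wpmul2l // Ex_sparsity_le.
by rewrite -EFinM mulrAC.
Qed.

(** The Borel-Cantelli lemma: the bounds of [prob_isolated_le] are summable by
    [sum_inv_sqr_le]. *)
Lemma ae_finitely_many_isolated_births :
  {ae P, forall w, edge_rich w -> exists t0, forall t, (t0 <= t)%N -> new_nbrs t w != finset.set0}.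
Proof.
pose F n := [set w | edge_rich w && (new_nbrs (s + n) w == finset.set0)].
have mF n : measurable (F n).
  apply: (@adapted_measurable (s + n).+1); first by rewrite (leq_trans vs) // -addnS leq_addr.
  by move=> w w' h; rewrite /F /= (adapted_isolated h).
have s0 : (0 < s)%N by exact: leq_trans s48.
exists (lim_sup_set F); split.
- by apply: bigcap_measurable => // n _; apply: bigcup_measurable => k _; exact: mF.
- apply: lim_sup_set_cvg0 => //.
  apply: (@le_lt_trans _ _ (27 * s%:R ^+ 5 * (2 * s%:R^-1))%:E); last by rewrite ltry.
  apply: lime_le; first by apply: is_cvg_nneseries => n _ _; exact: measure_ge0.
  apply: nearW => n.
  apply: (@le_trans _ _ (\sum_(0 <= i < n) (27 * s%:R ^+ 5 * ((s + i)%:R ^+ 2)^-1)%:E)%E).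
    by apply: lee_sum => i _; exact: prob_isolated_le.
  rewrite sumEFin lee_fin -mulr_sumr ler_wpM2l ?mulr_ge0 ?exprn_ge0 //.
  rewrite big_mkord (le_trans (sum_inv_sqr_le R n s0)) // ler_wpM2l //.
  by rewrite gerBl invr_ge0.
- move=> w /= /not_implyP[dw h] n _ /=.
  apply: contrapT => hn; apply: h; exists (s + n)%N => t st.
  apply/negP => /eqP e; apply: hn; exists (t - s)%N => /=; first by lia.
  by rewrite /F /= dw subnKC; [rewrite e eqxx|lia].
Qed.

End IsolatedBirths.
End Process.

(** * The infinite limit *)

Lemma ae_all_countable (R : realType) (d : measure_display)
    (T : measurableType d) (P : probability T R) (J : countType)
    (Q : J -> T -> Prop) :
  (forall j, {ae P, forall w, Q j w}) -> {ae P, forall w, forall j, Q j w}.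
Proof.
move=> h.
have : {ae P, forall w, forall n, if unpickle n is Some j then Q j w else True}.
  apply: ae_foralln => n; case: (unpickle n) => [j|]; first exact: h.
  exact: aeW.
by apply: filterS => w hw j; have := hw (pickle j); rewrite pickleK.
Qed.

Section Limit.
Variables (R : realType) (d : measure_display) (T : measurableType d).
Variables (P : probability T R) (v' : nat) (G' : sgraph 'I_v'.+1).
Variable G : nat -> T -> sgraph nat.
Hypothesis hG : preferential_attachment P G' G.
Hypothesis hv : (1 <= v')%N.

Let L w : sgraph nat := limit_graph (fun t => G t w).

Lemma pa_adj_init t w u v : G t w u v -> G (maxn v' t) w u v.
Proof.
case: (leqP v' t) => [//|/ltnW tv h].
have := pa_support hG h; rewrite (maxn_idPl tv) => /andP[uv vv].
have := pa_init hG w (Ordinal (uv : u < v'.+1)%N) (Ordinal (vv : v < v'.+1)%N).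
by move=> /[dup] /(_ _ (leqnn v')) -> /(_ _ tv) /= <-.
Qed.

Lemma limitE t w u v : (v' <= t)%N -> (u <= t)%N -> (v <= t)%N ->
  L w u v = G t w u v.
Proof.
move=> vt ut wt; apply/asboolP/idP => [[t0 /pa_adj_init]|h]; last by exists t.
set t1 := maxn v' t0; have vt1 : (v' <= t1)%N by exact: leq_maxl.
move=> h; have [ut1 wt1] := pa_edge_le hG vt1 h.
have [tt1|/ltnW tt1] := leqP t t1.
  by rewrite -(pa_stable hG w vt tt1).
by rewrite (pa_stable hG w vt1 tt1).
Qed.

Lemma limit_new t w (u : 'I_t.+1) : (v' <= t)%N -> L w t.+1 u = (u \in new_nbrs G t w).
Proof.
by move=> vt; rewrite in_new_nbrs (limitE _ (leqW vt)) // ltnW.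
Qed.

(** There are countably many finite patterns and starting times, so the
    recurrence of patterns holds for all of them at once. A vertex that is not
    isolated, or not universal, in the limit shows it at a finite time, from
    which the pattern can be started. *)
Lemma ae_extension : {ae P, forall w, extension_property (L w)}.
Proof.
pose D (j : nat * seq nat * seq nat) : pred nat := fun u => u \in j.1.2 ++ j.2.
pose Q j w := (v' <= j.1.1)%N -> (forall u, D j u -> (u <= j.1.1)%N) ->
  alive G j.1.1 (D j) (fun u => u \in j.2) w ->
  exists n, matches G (D j) (fun u => u \in j.2) (j.1.1 + n) w.
have : {ae P, forall w, forall j, Q j w}.
  apply: ae_all_countable => j.
  have [vs|nvs] := leqP v' j.1.1; last first.
    by apply: aeW => w vs; move: nvs; rewrite ltnNge vs.
  have [Ds|nDs] := pselect (forall u, D j u -> (u <= j.1.1)%N); last first.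
    by apply: aeW => w _ /nDs.
  have := ae_matches hG hv (fun u => u \in j.2) vs Ds.
  by apply: filterS => w h _ _.
apply: filterS => w hQ A B m hA hB AB.
have [M hM] : exists M, forall u, u \in A ++ B -> exists v, [/\ (v <= M)%N, (u <= M)%N &
    if u \in B then L w u v else (v != u) && ~~ L w u v].
  have : forall u, u \in A ++ B -> exists v,
      if u \in B then L w u v else (v != u) && ~~ L w u v.
    move=> u; rewrite mem_cat; case: (boolP (u \in B)) => [/hB //|uB].
    by rewrite orbF => /hA[v vu h]; exists v; rewrite vu.
  elim: (A ++ B) => [|u s IH] h; first by exists 0%N.
  have [M hM] := IH (fun u us => h u (mem_behead (us : u \in behead (_ :: s)))).
  have [v hv'] := h u (mem_head _ _).
  (* One bound serves for all vertices, their witnesses included. *)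
  exists (maxn M (maxn u v)) => x; rewrite inE => /orP[/eqP ->|/hM[y [yM xM hy]]].
    by exists v; split; rewrite // !leq_max leqnn ?orbT.
  by exists y; split; rewrite // leq_max ?yM ?xM.
pose s := maxn m (maxn v' M).
have ms : (m <= s)%N by rewrite leq_maxl.
have vs : (v' <= s)%N by rewrite !leq_max leqnn orbT.
have Ms : (M <= s)%N by rewrite !leq_max leqnn !orbT.
have Ds u : u \in A ++ B -> (u <= s)%N.
  by move=> /hM[v [_ uM _]]; exact: leq_trans Ms.
have [|n] := hQ (s, A, B) vs Ds.
  apply/forallP => u; apply/implyP => uAB.
  have [v [vM _]] := hM u uAB.
  have us := Ds u uAB; have vs' := leq_trans vM Ms.
  rewrite /degb (limitE _ vs us vs').
  case: ifP => _ h; first exact: deg_gt0 h.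
  by case/andP: h => vu h; rewrite subn_gt0; exact: deg_lt h.
move=> /forallP h; exists (s + n).+1.
have key u : u \in A ++ B -> L w (s + n).+1 u = (u \in B).
  move=> uAB; have un : (u < (s + n).+1)%N by rewrite ltnS (leq_trans (Ds _ uAB)) ?leq_addr.
  have := h (Ordinal un); rewrite /= /D /= uAB /= => /eqP <-.
  by rewrite -limit_new // (leq_trans vs) ?leq_addr.
split; first by rewrite (leq_trans ms) // leqW // leq_addr.
  by move=> b bB; rewrite key // mem_cat bB orbT.
by move=> a aA; rewrite key ?mem_cat ?aA // AB.
Qed.

(** The pattern that consists of one prescribed edge to [a] recurs. *)
Lemma degree_unbounded w a b : extension_property (L w) -> L w a b ->
  forall k, exists t, [/\ (v' <= t)%N, (a <= t)%N & (k <= deg t (G t w) a)%N].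
Proof.
move=> ext Lab; elim=> [|k [t [vt at' ht]]].
  by exists (maxn v' a); rewrite !leq_max !leqnn orbT.
have [x [tx xa _]] : exists x, [/\ (t.+1 <= x)%N, forall b, b \in [:: a] -> L w x b
                & forall a, a \in [::] -> ~~ L w x a].
  by apply: ext => // c; rewrite inE => /eqP ->; exists b.
case: x tx xa => // y; rewrite ltnS => ty /(_ a (mem_head _ _)) ya.
have vy : (v' <= y)%N by exact: leq_trans ty.
have ay : (a < y.+1)%N by rewrite ltnS (leq_trans at').
exists y.+1; split; [exact: leqW|exact: ltnW|].
rewrite -[a]/(nat_of_ord (Ordinal ay)) (deg_step hG) //.
rewrite -limit_new // [X in (_ + X)%N](_ : _ = 1%N) ?addn1 ?ltnS; last by rewrite ya.
rewrite (leq_trans ht) //= !deg_sum.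
rewrite (big_ord_widen y.+1 (fun v => G t w a v : nat)) // big_mkcond /=.
apply: leq_sum => v _; case: ifP => // vt'.
by rewrite (pa_stable hG w vt ty).
Qed.

(** The degree of an end of an edge of [G'] is unbounded, so the sum of the
    degrees eventually exceeds the threshold required for isolated births to
    be finitely many. *)
Lemma ae_no_late_isolated : ~ edgeless_graph G' ->
  {ae P, forall w, exists t0, forall t, (t0 <= t)%N -> exists u : 'I_t.+1, L w t.+1 u}.
Proof.
move=> nG'.
have [a [b Gab]] : exists a b, G' a b.
  apply: contrapT => h; apply: nG' => a b; apply/negP => ?; apply: h.
  by exists a, b.
have : {ae P, forall w, forall s, (v' <= s)%N -> (48 <= s)%N -> edge_rich G s w ->
   exists t0, forall t, (t0 <= t)%N -> new_nbrs G t w != finset.set0}.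
  apply: ae_all_countable => s.
  have [vs|nvs] := leqP v' s; last by apply: aeW.
  have [s48|ns] := leqP 48 s; last by apply: aeW.
  have := ae_finitely_many_isolated_births hG hv vs s48.
  by apply: filterS => w h _ _.
apply: filterS2 ae_extension => w ext h.
have Lab : L w a b.
  by rewrite (@limitE v') ?(pa_init hG) // -ltnS.
have [t [vt at' ht]] := degree_unbounded ext Lab 48.
have dt : (48 <= degsum G t w)%N.
  apply: leq_trans ht _; have at1 : (a < t.+1)%N by [].
  by rewrite /degsum (bigD1 (Ordinal at1)) //= leq_addr.
have [t0 ht0] : exists t0, forall t, (t0 <= t)%N -> new_nbrs G t w != finset.set0.
  apply: (h (maxn 48 t)); rewrite ?leq_max ?vt ?orbT //.
  by rewrite /edge_rich (leq_trans dt) // (degsum_le hG) // leq_maxr.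
exists (maxn v' t0) => t1; rewrite geq_max => /andP[vt1 /ht0/finset.set0Pn[u ut1]].
by exists u; rewrite limit_new.
Qed.

Lemma ae_edgeless : edgeless_graph G' -> {ae P, forall w, edgeless_graph (L w)}.
Proof.
move=> eG'.
have : {ae P, forall w, forall tu : nat * nat, (v' <= tu.1)%N -> (tu.2 <= tu.1)%N ->
    deg tu.1 (G tu.1 w) tu.2 = 0%N -> ~~ L w tu.1.+1 tu.2}.
  apply: ae_all_countable => -[t u] /=.
  have [vt|nvt] := leqP v' t; last by apply: aeW.
  have [ut|nut] := leqP u t; last by apply: aeW.
  have ut1 : (u < t.+1)%N by [].
  have := ae_no_edge_deg0 hG hv (Ordinal ut1) vt.
  apply: filterS => w h _ _ d0; move: h; rewrite /= d0 eqxx /=.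
  by rewrite -limit_new.
apply: filterS => w h.
have none n u v : (u <= v' + n)%N -> (v <= v' + n)%N -> ~~ L w u v.
  elim: n u v => [|n IH] u v.
    rewrite addn0 => uv vv; rewrite (@limitE v') //.
    have := pa_init hG w (Ordinal (uv : u < v'.+1)%N) (Ordinal (vv : v < v'.+1)%N) (leqnn v').
    by move=> /= ->; exact: eG'.
  have last_step x : (x <= v' + n)%N -> ~~ L w (v' + n).+1 x.
    move=> xn; apply: (h (v' + n, x)%N); rewrite ?leq_addr //=.
    rewrite deg_sum big1 // => y _; have yn : (y <= v' + n)%N by rewrite -ltnS.
    by rewrite -limitE ?leq_addr // (negbTE (IH _ _ xn yn)).
  have split x : (x <= v' + n.+1)%N -> x = (v' + n).+1 \/ (x <= v' + n)%N by lia.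
  move=> /split[->|un] /split[->|vn].
  - by rewrite adj_irr.
  - exact: last_step.
  - by rewrite adj_sym; exact: last_step.
  - exact: IH.
by move=> u v; apply: (none (maxn u v)); rewrite (leq_trans _ (leq_addl _ _)) // leq_max leqnn ?orbT.
Qed.

End Limit.

(** * Symmetry under complementation *)

Section ComplementProcess.
Variables (R : realType) (d : measure_display) (T : measurableType d).
Variables (P : probability T R) (v' : nat) (G' : sgraph 'I_v'.+1).
Variable G : nat -> T -> sgraph nat.
Hypothesis hG : preferential_attachment P G' G.
Hypothesis hv : (1 <= v')%N.

Let Gc t w : sgraph nat := compl_graph (fun u => (u <= maxn v' t)%N) (G t w).

(** Complementing the new neighbourhood exchanges [p u] and [1 - p u], and [1
    - deg / t] is the attachment probability of the complementary degree. *)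
Lemma compl_preferential_attachment :
  preferential_attachment P (compl_graph xpredT G') Gc.
Proof.
split.
- move=> t u v /=; rewrite /compl_adj.
  case: (boolP [&& (u <= maxn v' t)%N, (v <= maxn v' t)%N & u != v]) => h.
    rewrite (_ : [set w | _] = ~` [set w | G t w u v]).
      exact/measurableC/(pa_measurable hG).
    by case/and3P: h => -> -> ->; apply/seteqP; split => w /= /negP.
  rewrite (_ : [set w | _] = set0) //; apply/seteqP; split => w //= /and4P[a b c _].
  by case/negP: h; rewrite a b c.
- by move=> t w u v /and4P[-> ->].
- move=> t w i j tv; have le_v' (k : 'I_v'.+1) : (k <= v')%N by rewrite -ltnS.
  rewrite /= /compl_adj (maxn_idPl tv) !le_v' /=.
  by rewrite (pa_init hG) // -val_eqE.
- move=> t w u v vt ut wt; rewrite /= /compl_adj (pa_step hG) //.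
  by rewrite !leq_max ut wt (leqW ut) (leqW wt) !orbT.
move=> t h N vt history new_edges p.
have vt1 := leqW vt.
(* A history that occurs is that of some outcome w0, whose original graphs
   replace h; complementation is injective on graphs with the same support. *)
have [[w0 hw0]|nh] := pselect (history !=set0); last first.
  have -> : history = set0 by apply/seteqP; split => // w hw; case: nh; exists w.
  by rewrite set0I measure0 mul0e.
have eqG w : (forall s u v, (s <= t)%N -> Gc s w u v = Gc s w0 u v) ->
    forall s u v, (s <= t)%N -> G s w u v = G s w0 u v.
  move=> e s u v st; have := e s u v st; rewrite /= /compl_adj.
  have [->|uv] := eqVneq u v; first by rewrite !adj_irr.
  case: (boolP (u <= _)%N) => us; last first.
    by move=> _; apply/idP/idP => /(pa_support hG)/andP[us' _]; move: us; rewrite us'.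
  case: (boolP (v <= _)%N) => ws; last first.
    by move=> _; apply/idP/idP => /(pa_support hG)/andP[_ ws']; move: ws; rewrite ws'.
  by rewrite /= => /negb_inj.
have -> : history = [set w | forall s u v, (s <= t)%N -> G s w u v = G s w0 u v].
  apply/seteqP; split => w /= hw.
    by apply: eqG => s u v st; rewrite hw // hw0.
  move=> s u v st; rewrite -hw0 //= /compl_adj hw //.
have -> : new_edges = [set w | forall u : 'I_t.+1, G t.+1 w t.+1 u = (u \in ~: N)%SET].
  have e w (u : 'I_t.+1) : Gc t.+1 w t.+1 u = ~~ G t.+1 w t.+1 u.
    rewrite /= /compl_adj !leq_max leqnn (ltnW (ltn_ord u)) !orbT /=.
    by rewrite gtn_eqF.
  apply/seteqP; split => w /= hw u; have := hw u.
    by rewrite e finset.inE => <-; rewrite negbK.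
  by rewrite e finset.inE => ->; rewrite negbK.
rewrite (@pa_law _ _ _ _ _ _ _ hG t (fun s => G s w0) _ vt); congr (_ * (_)%:E)%E.
apply: eq_bigr => u _; rewrite finset.inE /p.
have ut : (u <= t)%N by rewrite -ltnS.
have -> : deg t (h t) u = (t - deg t (G t w0) u)%N.
  rewrite -deg_compl //; apply: eq_card => v.
  by rewrite !inE -hw0 // /Gc (maxn_idPr vt).
rewrite natrB ?deg_le // mulrBl divff ?pnatr_eq0 -?lt0n ?(leq_trans hv) //.
by case: (u \in N) => //=; ring.
Qed.

Lemma limit_compl w u v : limit_graph (fun t => Gc t w) u v =
  (u != v) && ~~ limit_graph (fun t => G t w) u v.
Proof.
set t := maxn v' (maxn u v).
have vt : (v' <= t)%N by exact: leq_maxl.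
have ut : (u <= t)%N by rewrite !leq_max leqnn orbT.
have wt : (v <= t)%N by rewrite !leq_max leqnn !orbT.
rewrite (limitE compl_preferential_attachment w vt ut wt) (limitE hG w vt ut wt).
by rewrite /= /compl_adj (maxn_idPr vt) ut wt.
Qed.

End ComplementProcess.

(** * The trichotomy *)

Theorem theorem2p3 (R : realType) (d : measure_display) (T : measurableType d)
    (P : probability T R) (v' : nat) (G' : sgraph 'I_v'.+1)
    (G : nat -> T -> sgraph nat) (hv : (1 <= v')%N)
    (hG : preferential_attachment P G' G) :
  [/\ complete_graph G' ->
        {ae P, forall w, complete_graph (limit_graph (fun t => G t w))},
      edgeless_graph G' ->
        {ae P, forall w, edgeless_graph (limit_graph (fun t => G t w))}
    & ~ complete_graph G' -> ~ edgeless_graph G' ->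
        {ae P, forall w,
           rado_plus_isolated (limit_graph (fun t => G t w)) \/
           rado_plus_universal (limit_graph (fun t => G t w))}].
Proof.
have hGc := compl_preferential_attachment hG hv.
split.
- move=> cG'; have : edgeless_graph (compl_graph xpredT G').
    move=> u v; rewrite /= /compl_adj /=; have [//|/eqP uv] := eqVneq u v.
    by rewrite cG'.
  move/(ae_edgeless hGc hv); apply: filterS => w h u v /eqP uv.
  by have := h u v; rewrite (limit_compl hG hv) uv /= negbK.
- exact: ae_edgeless.
- move=> ncG' neG'.
  have necG' : ~ edgeless_graph (compl_graph xpredT G').
    move=> h; apply: ncG' => u v /eqP uv; have := h u v.
    by rewrite /= /compl_adj /= uv negbK.
  have h1 := ae_extension hG hv.
  have h2 := ae_no_late_isolated hG hv neG'.
  have h3 := ae_no_late_isolated hGc hv necG'.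
  apply: filterS3 h1 h2 h3 => w ext [t1 ht1] [t2 ht2].
  apply: (@rado_dichotomy _ (maxn t1 t2).+1 ext) => -[//|u]; rewrite ltnS geq_max => /andP[u1 u2].
    by have [v uv] := ht1 u u1; exists v.
  have [v] := ht2 u u2; rewrite (limit_compl hG hv) eq_sym => /andP[? ?].
  by exists (nat_of_ord v).
Qed.
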